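(* Let $T_\delta:[0,1]\to[0,1]$, $\delta\in[0,\bar\delta)$, be Borel-measurable maps and let $\rho$ be a Lipschitz probability density on $\mathbb R$ supported on $[-1,1]$. Let $L_\delta:L^2([0,1],\mathbb C)\to L^2([0,1],\mathbb C)$, $L_\delta f(x)=\int k_\delta(x,y)f(y)\,dy$, $\delta\in[0,\bar\delta)$, be the integral operators generated by the kernels $k_\delta(x,y)=(P_\pi\tau_{-T_\delta(y)}\rho)(x)$. Assume that $d\rho/dx$ is Lipschitz and that $\delta\mapsto T_\delta$ is $C^1$, with derivative $\dot T$ at $\delta=0$. Let $\lambda_\delta$ be an eigenvalue of $L_\delta$ with second largest magnitude strictly inside the unit disk. Suppose that $L_0$ satisfies (A1): $\lim_{n\to\infty}\|L_0^ng\|_2=0$ for every $g$ with $\int g\,dm=0$, and that $\lambda_0$ is geometrically simple. Then $$\frac{d\lambda_\delta}{d\delta}\bigg|_{\delta=0}=\langle H,\dot T\rangle_{L^2([0,1],\mathbb C)},\qquad H(y)=-\overline{e(y)}\int_0^1\left(P_\pi\left(\tau_{-T_0(y)}\frac{d\rho}{dx}\right)\right)(x)\,\hat e(x)\,dx,$$ where $e$ is the eigenvector of $L_0$ associated to the eigenvalue $\lambda_0$ and $\hat e$ is the eigenvector of $L_0^*$ associated to the eigenvalue $\lambda_0$.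
   Context: $m$ is Lebesgue measure on $[0,1]$. $\langle f,g\rangle_{L^2([0,1],\mathbb C)}=\int f\,\overline{g}\,dm$. For $b\in\mathbb R$, $(\tau_bg)(x):=g(x+b)$. For $f$ on $\mathbb R$, $P_\pi f(x):=\sum_{i\in2\mathbb Z}(f(i+x)+f(i-x))$, $x\in[0,1]$. $L_0^*$ is the adjoint of $L_0$. The map $\delta\mapsto T_\delta$ being $C^1$ is meant in $L^2$; in particular $T_\delta=T_0+\delta\dot T+t_\delta$ with $\dot T,t_\delta\in L^2$ and $\|t_\delta\|_2=o(\delta)$. $\lambda_\delta$ is the eigenvalue branch equal to $\lambda_0$ at $\delta=0$. The eigenvectors are normalised so that $\int e\,\overline{\hat e}\,dm=1$.
   Formalization: λ_0 is assumed nonzero (no isolated eigenvalue branch passes through 0), and L_0^*ê=λ_0ê is taken literally, which with ∫e·conj(ê)=1 forces λ_0 real; for non-real λ_0 with the conjugate convention the displayed formula would be the conjugate of the derivative. *)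

(* Defs.v *)
From mathcomp Require Import all_boot all_order all_algebra.
From mathcomp Require Import all_classical all_reals all_analysis.
From mathcomp Require Import complex.

Set Implicit Arguments.
Unset Strict Implicit.
Unset Printing Implicit Defensive.

Import Order.TTheory GRing.Theory Num.Theory.
Import numFieldNormedType.Exports.

Local Open Scope classical_set_scope.
Local Open Scope complex_scope.
Local Open Scope ring_scope.

Section Defs.
Context {R : realType}.

Local Notation m := (@lebesgue_measure R).
Local Notation I := (`[0%R, 1%R]%classic : set R).
Local Notation normc := ComplexField.Normc.normc.

(* Elements of L^2([0,1], C) are handled through representatives R -> R[i];
   only their values on [0,1] matter, and equality in L^2 is ae_eq01. *)

Definition ae_eq01 (f g : R -> R[i]) : Prop := f = g %[ae m in I].

Definition cintegral (f : R -> R[i]) : R[i] :=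
  (\int[m]_(x in I) complex.Re (f x)) +i* (\int[m]_(x in I) complex.Im (f x)).

Definition L2 (f : R -> R[i]) : Prop :=
  [/\ measurable_fun I (fun x => complex.Re (f x)),
      measurable_fun I (fun x => complex.Im (f x)) &
      (\int[m]_(x in I) (normc (f x) ^+ 2)%:E < +oo)%E].

(* Num.sqrt of a real-valued integral: meaningful for f in L2 only
   (a divergent integral would be read as 0). *)
Definition L2norm (f : R -> R[i]) : R :=
  Num.sqrt (\int[m]_(x in I) (normc (f x) ^+ 2)).

Definition inner (f g : R -> R[i]) : R[i] := cintegral (fun x => f x * ((g x)^*)%C).

Definition is_adjoint (L Ls : (R -> R[i]) -> (R -> R[i])) : Prop :=
  (forall g, L2 g -> L2 (Ls g)) /\
  (forall f g, L2 f -> L2 g -> inner (L f) g = inner f (Ls g)).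

Definition is_eigenvector (L : (R -> R[i]) -> (R -> R[i])) (l : R[i])
    (f : R -> R[i]) : Prop :=
  [/\ L2 f, ~ ae_eq01 f (fun=> 0) & ae_eq01 (L f) (fun x => l * f x)].

Definition is_eigenvalue (L : (R -> R[i]) -> (R -> R[i])) (l : R[i]) : Prop :=
  exists f, is_eigenvector L l f.

Definition geometrically_simple (L : (R -> R[i]) -> (R -> R[i])) (l : R[i]) :
    Prop :=
  exists2 e, is_eigenvector L l e &
    forall f, is_eigenvector L l f -> exists c : R[i], ae_eq01 f (fun x => c * e x).

Definition second_largest_eigenvalue (L : (R -> R[i]) -> (R -> R[i]))
    (l : R[i]) : Prop :=
  is_eigenvalue L l /\
  exists mu : R[i], [/\ is_eigenvalue L mu, `|l| < `|mu| &
    forall nu, is_eigenvalue L nu -> nu != mu -> `|nu| <= `|l|].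

Definition A1 (L : (R -> R[i]) -> (R -> R[i])) : Prop :=
  forall g, L2 g -> cintegral g = 0 -> L2norm (iter n L g) @[n --> \oo] --> 0.

Definition tau (b : R) (g : R -> R) : R -> R := fun x => g (x + b).

(* The sum over 2Z is the finitely supported one (it is 0 if infinitely many
   terms are nonzero): to be used with f vanishing off a bounded set. *)
Definition P_pi (f : R -> R) : R -> R := fun x =>
  \sum_(i \in [set i : int | (2 %| i)%Z]) (f (i%:~R + x) + f (i%:~R - x)).

Definition noise_kernel (rho T : R -> R) (x y : R) : R :=
  P_pi (tau (- T y) rho) x.

Definition integral_operator (k : R -> R -> R) (f : R -> R[i]) : R -> R[i] :=
  fun x => cintegral (fun y => (k x y)%:C * f y).

Definition lipschitz_density (rho : R -> R) : Prop :=
  [/\ lipschitz rho, (forall x, 0 <= rho x),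
      (\int[m]_x (rho x)%:E = 1)%E &
      closure [set x | rho x != 0] `<=` `[-1, 1]%classic].

(* T : [0, dbar) -> L^2([0,1]) is C^1 with derivative dT, one-sided at 0. *)
Definition C1_L2 (dbar : R) (T dT : R -> R -> R) : Prop :=
  let J := `[0, dbar[%classic : set R in
  forall d, J d ->
  [/\ L2 (fun x => (dT d x)%:C),
      L2norm (fun x => ((s - d)^-1 * (T s x - T d x) - dT d x)%:C)
        @[s --> within J d^'] --> 0 &
      L2norm (fun x => (dT s x - dT d x)%:C) @[s --> within J d^'] --> 0].

End Defs.

(* Main.v *)
Require Import Defs.
From mathcomp Require Import all_boot all_order all_algebra.
From mathcomp Require Import all_classical all_reals all_analysis.
From mathcomp Require Import measurable_realfun complex.
From mathcomp Require Import ring lra zify.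

(* Pairing the eigenvalue equation of an eigenfunction [phi_d] of [L_d] with
   [ehat] gives the exact identity
     (mu_d - lambda_0) <phi_d, ehat> = <(L_d - L_0) phi_d, ehat>,
   so only the convergence of [phi_d] to a nonzero multiple of [e] is needed.
   Images under [L_d] are Lipschitz, uniformly in [d]; normalising [phi_d] in
   the supremum norm makes the family equi-Lipschitz, hence uniformly convergent
   along every ultrafilter finer than 0^+, and the limit is an eigenfunction of
   [L_0] for the geometrically simple [lambda_0]. Since <e, ehat> = 1 forces
   [lambda_0] to be real and the kernels are real, this is applied to the
   eigenvalues [mu_d] conjugate to [lambda_d]; this matches the conjugates in
   [H], whose pairing with [dT] is identified by Fubini's theorem. *)

Set Implicit Arguments.
Unset Strict Implicit.
Unset Printing Implicit Defensive.

Import Order.TTheory GRing.Theory Num.Theory.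
Import numFieldNormedType.Exports.

Local Open Scope classical_set_scope.
Local Open Scope complex_scope.
Local Open Scope ring_scope.

Local Notation normc := ComplexField.Normc.normc.
Local Notation Re := complex.Re.
Local Notation Im := complex.Im.

(** * Modulus, real part and imaginary part of complex numbers *)

Section complex_modulus.
Context {R : realType}.
Implicit Types z w : R[i].

(** The maps are differentiable only in the L^2 sense, so [T d - T 0] is controlled through
    integrals and never pointwise. The sup-norm bound on [phi_d] is what allows the difference
    quotient of the kernels to be integrated against it with an error uniform in [x]. That error is
    small because the kernel has a quadratic Taylor remainder in its second argument, which after
    division by [d] costs [d^-1] times the integral of [(T d - T 0) ^+ 2]. The identity is divided
    by [d] and by [<phi_d, ehat>], whose limit is nonzero. The [phi_d] are arbitrary choices with no
    regularity in [d], and the multiple of [e] that they approach may change with the ultrafilter;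
    but this multiple cancels from the quotient. Every ultrafilter thus gives the same limit, which
    is then the limit at 0^+. *)

Lemma normc_ge0 z : 0 <= normc z.
Proof. by case: z => a b; rewrite /= sqrtr_ge0. Qed.

Lemma normr_complexE z : `|z| = (normc z)%:C.
Proof. by case: z. Qed.

Lemma normc_real (a : R) : normc a%:C = `|a|.
Proof. by rewrite /= expr0n /= addr0 sqrtr_sqr. Qed.

Lemma normc_conj z : normc (z^*)%C = normc z.
Proof. by case: z => a b /=; rewrite sqrrN. Qed.

Lemma normcD z w : normc (z + w) <= normc z + normc w.
Proof. by rewrite -lecR rmorphD/= -!normr_complexE ler_normD. Qed.

Lemma normc_opp z : normc (- z) = normc z.
Proof. by case: z => a b /=; rewrite !sqrrN. Qed.

Lemma normcB z w : normc (z - w) = normc (w - z).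
Proof. by apply: complexI; rewrite -!normr_complexE distrC. Qed.

Lemma normr_Re_le z : `|Re z| <= normc z.
Proof.
by case: z => a b /=; rewrite -sqrtr_sqr ler_wsqrtr// lerDl sqr_ge0.
Qed.

Lemma normr_Im_le z : `|Im z| <= normc z.
Proof.
by case: z => a b /=; rewrite -sqrtr_sqr ler_wsqrtr// lerDr sqr_ge0.
Qed.

Lemma normc_le_ReIm z : normc z <= `|Re z| + `|Im z|.
Proof.
rewrite {1}(complexE z); apply: (le_trans (normcD _ _)).
rewrite ComplexField.Normc.normcM !normc_real lerD2l.
by rewrite /= expr0n /= expr1n add0r sqrtr1 mul1r.
Qed.

Lemma normc_eq0 z : (normc z == 0) = (z == 0).
Proof.
apply/eqP/eqP => [/ComplexField.Normc.eq0_normc//|->].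
exact: ComplexField.Normc.normc0.
Qed.

Lemma Re_sub z w : Re (z - w) = Re z - Re w.
Proof. by case: z; case: w. Qed.

Lemma Im_sub z w : Im (z - w) = Im z - Im w.
Proof. by case: z; case: w. Qed.

Lemma Re_add z w : Re (z + w) = Re z + Re w.
Proof. by case: z; case: w. Qed.

Lemma Im_add z w : Im (z + w) = Im z + Im w.
Proof. by case: z; case: w. Qed.

Lemma Re_mul z w : Re (z * w) = Re z * Re w - Im z * Im w.
Proof. by case: z; case: w. Qed.

Lemma Im_mul z w : Im (z * w) = Re z * Im w + Im z * Re w.
Proof. by case: z; case: w. Qed.

Lemma Re_conj z : Re (z^*)%C = Re z.
Proof. by case: z. Qed.

Lemma Im_conj z : Im (z^*)%C = - Im z.
Proof. by case: z. Qed.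

Lemma Re_rM (a : R) z : Re (a%:C * z) = a * Re z.
Proof. by rewrite Re_mul /= mul0r subr0. Qed.

Lemma Im_rM (a : R) z : Im (a%:C * z) = a * Im z.
Proof. by rewrite Im_mul /= mul0r addr0. Qed.

Lemma complex_ext z w : Re z = Re w -> Im z = Im w -> z = w.
Proof. by case: z; case: w => /= ? ? ? ? -> ->. Qed.

Lemma cvgc_normcP {T : Type} (F : set_system T) {FF : Filter F}
    (f : T -> R[i]) (l : R[i]) :
  (f t : R[i]^o) @[t --> F] --> (l : R[i]^o) <->
  normc (f t - l) @[t --> F] --> 0.
Proof.
split=> [/cvgrPdist_lt fl|/cvgrPdist_lt fl]; apply/cvgrPdist_lt => e e0.
  have ec : 0 < e%:C by rewrite ltcR.
  near=> t; rewrite sub0r normrN ger0_norm ?normc_ge0//.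
  rewrite -ltcR -normr_complexE distrC.
  by near: t; exact: fl.
(* The radius [e] is a complex number here; in the partial order of [R[i]], [0 < e] forces it to be
   real. *)
have /andP[/eqP ime ree] : (Im e == 0) && (0 < Re e).
  by move: e0; rewrite ltcE /=.
have /fl := ree; apply: filterS => t; rewrite sub0r normrN ger0_norm ?normc_ge0//.
move=> h; rewrite distrC; rewrite (_ : e = (Re e)%:C).
  by rewrite normr_complexE ltcR.
by apply: complex_ext => //=.
Unshelve. all: by end_near. Qed.

End complex_modulus.

(** * Complex-valued integrals and L^2 functions on [0, 1] *)

Section complex_integral.
Context {R : realType}.
Local Notation m := (@lebesgue_measure R).
Local Notation I := (`[0%R, 1%R]%classic : set R).
Implicit Types (f g h : R -> R[i]) (u v : R -> R).

Definition cmeasurable f :=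
  measurable_fun I (fun x => Re (f x)) /\ measurable_fun I (fun x => Im (f x)).

Definition cintegrable f :=
  m.-integrable I (EFin \o (fun x => Re (f x))) /\
  m.-integrable I (EFin \o (fun x => Im (f x))).

Lemma measurable_I : measurable (I : set R).
Proof. exact: measurable_itv. Qed.
Hint Resolve measurable_I : core.

Lemma integrableD_I u v : m.-integrable I (EFin \o u) ->
  m.-integrable I (EFin \o v) -> m.-integrable I (EFin \o (fun x => u x + v x)).
Proof.
move=> iu iv.
exact: (@integrableD _ _ _ m I measurable_I (EFin \o u) (EFin \o v) iu iv).
Qed.

Lemma integrableZl_I (a : R) u : m.-integrable I (EFin \o u) ->
  m.-integrable I (EFin \o (fun x => a * u x)).
Proof.
by move=> iu; exact: (@integrableZl _ _ _ m I measurable_I a (EFin \o u) iu).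
Qed.

Lemma integrable_norm_I u : m.-integrable I (EFin \o u) ->
  m.-integrable I (EFin \o (fun x => `|u x|)).
Proof. exact: integrable_abse. Qed.

Lemma cmeasurableD f g : cmeasurable f -> cmeasurable g ->
  cmeasurable (fun x => f x + g x).
Proof.
move=> [f1 f2] [g1 g2]; split.
  apply: (eq_measurable_fun (fun x => Re (f x) + Re (g x))).
    by move=> x _; rewrite Re_add.
  exact: measurable_funD.
apply: (eq_measurable_fun (fun x => Im (f x) + Im (g x))).
  by move=> x _; rewrite Im_add.
exact: measurable_funD.
Qed.

Lemma cmeasurableB f g : cmeasurable f -> cmeasurable g ->
  cmeasurable (fun x => f x - g x).
Proof.
move=> [f1 f2] [g1 g2]; split.
  apply: (eq_measurable_fun (fun x => Re (f x) - Re (g x))).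
    by move=> x _; rewrite Re_sub.
  exact: measurable_funB.
apply: (eq_measurable_fun (fun x => Im (f x) - Im (g x))).
  by move=> x _; rewrite Im_sub.
exact: measurable_funB.
Qed.

Lemma cmeasurableM f g : cmeasurable f -> cmeasurable g ->
  cmeasurable (fun x => f x * g x).
Proof.
move=> [f1 f2] [g1 g2]; split.
  apply: (eq_measurable_fun (fun x => Re (f x) * Re (g x) - Im (f x) * Im (g x))).
    by move=> x _; rewrite Re_mul.
  by apply: measurable_funB; exact: measurable_funM.
apply: (eq_measurable_fun (fun x => Re (f x) * Im (g x) + Im (f x) * Re (g x))).
  by move=> x _; rewrite Im_mul.
by apply: measurable_funD; exact: measurable_funM.
Qed.

Lemma cmeasurable_conj f : cmeasurable f -> cmeasurable (fun x => (f x)^*%C).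
Proof.
move=> [f1 f2]; split.
  by apply: eq_measurable_fun f1 => x _; rewrite Re_conj.
apply: (eq_measurable_fun (fun x => - Im (f x))).
  by move=> x _; rewrite Im_conj.
exact: measurableT_comp.
Qed.

Lemma cmeasurable_real u : measurable_fun I u -> cmeasurable (fun x => (u x)%:C).
Proof. by move=> mu; split => //=; exact: measurable_cst. Qed.

Lemma cmeasurable_cst (c : R[i]) : cmeasurable (fun=> c).
Proof. by split; exact: measurable_cst. Qed.

Lemma cmeasurable_normc f : cmeasurable f -> measurable_fun I (fun x => normc (f x)).
Proof.
move=> [f1 f2].
have -> : (fun x => normc (f x)) = fun x => Num.sqrt ((Re (f x)) ^+ 2 + (Im (f x)) ^+ 2).
  by apply/funext => x /=; case: (f x).
apply: (@measurableT_comp _ _ _ _ _ _ (@Num.sqrt R)) => //.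
  exact: continuous_measurable_fun (@sqrt_continuous R).
by apply: measurable_funD; exact: measurable_funX.
Qed.

Lemma cintegrable_measurable f : cintegrable f -> cmeasurable f.
Proof.
by move=> [/measurable_int/measurable_EFinP ? /measurable_int/measurable_EFinP ?].
Qed.

Lemma cintegrable_dominated f v : cmeasurable f -> m.-integrable I (EFin \o v) ->
  (forall x, I x -> normc (f x) <= v x) -> cintegrable f.
Proof.
move=> [f1 f2] iv fv; split.
- apply: le_integrable iv => //; first exact/measurable_EFinP.
  move=> x Ix; rewrite lee_fin (le_trans (normr_Re_le _))//.
  by rewrite (le_trans (fv x Ix))// ler_norm.
- apply: le_integrable iv => //; first exact/measurable_EFinP.
  move=> x Ix; rewrite lee_fin (le_trans (normr_Im_le _))//.
  by rewrite (le_trans (fv x Ix))// ler_norm.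
Qed.

Lemma cintegrable_normc f : cintegrable f ->
  m.-integrable I (EFin \o (fun x => normc (f x))).
Proof.
move=> If; have mf := cintegrable_measurable If.
have [/integrable_norm_I f1 /integrable_norm_I f2] := If.
have := integrableD_I f1 f2.
apply: le_integrable => //.
  by apply/measurable_EFinP; exact: cmeasurable_normc.
move=> x Ix /=; rewrite lee_fin ger0_norm ?normc_ge0//.
by rewrite (le_trans (normc_le_ReIm _))// ler_norm.
Qed.

Lemma integrable_cst_I (c : R) : m.-integrable I (EFin \o (fun=> c)).
Proof.
apply: measurable_bounded_integrable => //.
  by rewrite /= lebesgue_measure_itv/= lte_fin ltr01 oppr0 adde0 ltry.
by exists `|c|; split => // y cy x _ /=; exact: ltW.
Qed.

Lemma cintegrable_bounded f (M : R) : cmeasurable f ->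
  (forall x, I x -> normc (f x) <= M) -> cintegrable f.
Proof. by move=> mf; apply: cintegrable_dominated => //; exact: integrable_cst_I. Qed.

Lemma cintegrableMl (M : R) f g : cmeasurable f ->
  (forall x, I x -> normc (f x) <= M) -> cintegrable g ->
  cintegrable (fun x => f x * g x).
Proof.
move=> mf fM Ig.
apply: (@cintegrable_dominated _ (fun x => M * normc (g x))).
- exact: cmeasurableM (cintegrable_measurable Ig).
- exact: (integrableZl_I M (cintegrable_normc Ig)).
- by move=> x Ix; rewrite ComplexField.Normc.normcM ler_wpM2r ?normc_ge0 ?fM.
Qed.

Lemma cintegrable_conj f : cintegrable f -> cintegrable (fun x => (f x)^*%C).
Proof.
move=> If; apply: (@cintegrable_dominated _ (fun x => normc (f x))).
- exact/cmeasurable_conj/cintegrable_measurable.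
- exact: cintegrable_normc.
- by move=> x _; rewrite normc_conj.
Qed.

Lemma cintegrableZl (c : R[i]) f : cintegrable f -> cintegrable (fun x => c * f x).
Proof. by apply: (cintegrableMl (M := normc c)) => //; exact: cmeasurable_cst. Qed.

Lemma cintegrableB f g : cintegrable f -> cintegrable g ->
  cintegrable (fun x => f x - g x).
Proof.
move=> If Ig; apply: (@cintegrable_dominated _ (fun x => normc (f x) + normc (g x))).
- by apply: cmeasurableB; exact: cintegrable_measurable.
- by apply: (integrableD_I (cintegrable_normc If) (cintegrable_normc Ig)).
- move=> x _; apply: (le_trans (normcD _ _)).
  by rewrite lerD2l normc_opp.
Qed.

Lemma cintegralB f g : cintegrable f -> cintegrable g ->
  cintegral (fun x => f x - g x) = cintegral f - cintegral g.
Proof.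
move=> [f1 f2] [g1 g2]; apply: complex_ext; rewrite ?(Re_sub, Im_sub) /=.
  by under eq_Rintegral do rewrite Re_sub; rewrite RintegralB.
by under eq_Rintegral do rewrite Im_sub; rewrite RintegralB.
Qed.

Lemma eq_cintegral f g : (forall x, I x -> f x = g x) -> cintegral f = cintegral g.
Proof.
by move=> fg; congr Complex; apply: eq_Rintegral => x /set_mem /fg ->.
Qed.

Lemma cintegralZl (c : R[i]) f : cintegrable f ->
  cintegral (fun x => c * f x) = c * cintegral f.
Proof.
move=> [f1 f2]; apply: complex_ext; rewrite ?(Re_mul, Im_mul) /=.
  under eq_Rintegral do rewrite Re_mul.
  by rewrite RintegralB//= ?RintegralZl//; exact: integrableZl_I.
under eq_Rintegral do rewrite Im_mul.
by rewrite RintegralD//= ?RintegralZl//; exact: integrableZl_I.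
Qed.

Lemma cintegral_conj f : cintegrable f ->
  cintegral (fun x => (f x)^*%C) = (cintegral f)^*%C.
Proof.
move=> [f1 f2]; apply: complex_ext; rewrite ?(Re_conj, Im_conj) /=.
  by under eq_Rintegral do rewrite Re_conj.
under eq_Rintegral do rewrite Im_conj -mulN1r.
by rewrite RintegralZl// mulN1r.
Qed.

(** Real and imaginary parts are bounded separately, whence the factor 2. It is not sharp, but every
    later use only needs some fixed constant. *)
Lemma normc_cintegral_le f v : cmeasurable f -> m.-integrable I (EFin \o v) ->
  (forall x, I x -> normc (f x) <= v x) ->
  normc (cintegral f) <= 2 * \int[m]_(x in I) v x.
Proof.
move=> mf iv fv; have [f1 f2] := cintegrable_dominated mf iv fv.
apply: (le_trans (normc_le_ReIm _)); rewrite mulr_natl mulr2n /= lerD//.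
  apply: (le_trans (le_normr_Rintegral _ _)) => //.
  apply: le_Rintegral => //; first exact: (integrable_norm_I f1).
  by move=> x Ix; rewrite (le_trans (normr_Re_le _)) ?fv.
apply: (le_trans (le_normr_Rintegral _ _)) => //.
apply: le_Rintegral => //; first exact: (integrable_norm_I f2).
by move=> x Ix; rewrite (le_trans (normr_Im_le _)) ?fv.
Qed.

Lemma ae_eq01_mono (f g f' g' : R -> R[i]) :
  (forall x, I x -> f x = g x -> f' x = g' x) -> ae_eq01 f g -> ae_eq01 f' g'.
Proof.
move=> fg [N [mN N0 subN]]; exists N; split=> // x /= nfg; apply: subN => /= fgx.
by apply: nfg => Ix; apply: fg => //; exact: fgx.
Qed.

Lemma ae_eq01_mono2 (f g f' g' f2 g2 : R -> R[i]) :
  (forall x, I x -> f x = g x -> f' x = g' x -> f2 x = g2 x) ->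
  ae_eq01 f g -> ae_eq01 f' g' -> ae_eq01 f2 g2.
Proof.
move=> fg h h'; have [N [mN N0 subN]] := negligibleU h h'.
exists N; split=> // x /= nfg; apply: subN; apply: contrapT.
move=> /not_orP[/contrapT h1 /contrapT h2].
by apply: nfg => Ix; apply: fg => //; [exact: h1|exact: h2].
Qed.

Lemma ae_eq01W f g : (forall x, I x -> f x = g x) -> ae_eq01 f g.
Proof. by move=> fg; apply: aeW. Qed.

Lemma ae_eq_cintegral f g : cmeasurable f -> cmeasurable g ->
  ae_eq01 f g -> cintegral f = cintegral g.
Proof.
move=> [f1 f2] [g1 g2] fg; congr Complex; congr fine; apply: ae_eq_integral => //.
- exact/measurable_EFinP.
- exact/measurable_EFinP.
- exact: (ae_eq_comp (fun z => (Re z)%:E) fg).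
- exact/measurable_EFinP.
- exact/measurable_EFinP.
- exact: (ae_eq_comp (fun z => (Im z)%:E) fg).
Qed.

Lemma L2_cmeasurable f : L2 f -> cmeasurable f.
Proof. by case. Qed.

Lemma L2_integrable_sqr f : L2 f -> m.-integrable I (EFin \o (fun x => normc (f x) ^+ 2)).
Proof.
move=> [f1 f2 foo]; apply/integrableP; split.
  apply/measurable_EFinP; apply: measurable_funX.
  exact: (cmeasurable_normc (conj f1 f2)).
by under eq_integral do rewrite gee0_abs ?lee_fin ?sqr_ge0//.
Qed.

Lemma L2_cintegrableM f g : L2 f -> L2 g -> cintegrable (fun x => f x * g x).
Proof.
move=> Lf Lg; apply: (@cintegrable_dominated _
  (fun x => normc (f x) ^+ 2 + normc (g x) ^+ 2)).
- by apply: cmeasurableM; exact: L2_cmeasurable.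
- by apply: (integrableD_I (L2_integrable_sqr Lf) (L2_integrable_sqr Lg)).
- move=> x _; rewrite ComplexField.Normc.normcM.
  have := normc_ge0 (f x); have := normc_ge0 (g x); nra.
Qed.

Lemma L2_bounded f (M : R) : cmeasurable f ->
  (forall x, I x -> normc (f x) <= M) -> L2 f.
Proof.
move=> mf fM; have [f1 f2] := mf; split => //.
have : m.-integrable I (EFin \o (fun=> M ^+ 2)) by exact: integrable_cst_I.
move=> iM.
suff /integrableP[_] : m.-integrable I (EFin \o (fun x => normc (f x) ^+ 2)).
  congr (_ < +oo)%E; apply: eq_integral => x _.
  by rewrite gee0_abs// lee_fin sqr_ge0.
apply: le_integrable iM => //.
  by apply/measurable_EFinP; apply: measurable_funX; exact: cmeasurable_normc.
move=> x Ix; rewrite lee_fin !ger0_norm ?sqr_ge0// lerXn2r ?nnegrE ?normc_ge0 ?fM//.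
by rewrite (le_trans (normc_ge0 _) (fM x Ix)).
Qed.

Lemma L2_cintegrable f : L2 f -> cintegrable f.
Proof.
move=> Lf; have : L2 (fun=> 1 : R[i]).
  by apply: (L2_bounded (M := 1)) (cmeasurable_cst _) _ => x _; rewrite ComplexField.Normc.normc1.
move=> /(L2_cintegrableM Lf).
by under eq_fun do rewrite mulr1.
Qed.

End complex_integral.

(** * The reflected noise kernel: bounds, Lipschitz continuity, Taylor expansion *)

Section folded_kernel.
Context {R : realType}.
Local Notation I := (`[0%R, 1%R]%classic : set R).
Implicit Types f rho : R -> R.

(* For [f] supported in [-1, 1] and [x], [t] in [0, 1], only the translates by
   -2, 0 and 2 contribute to [P_pi]. *)
Definition folded f (x t : R) : R :=
  \sum_(i <- [:: -2; 0; 2]) (f (i%:~R + x - t) + f (i%:~R - x - t)).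

Lemma P_pi_folded f x t : (forall u, 1 < `|u| -> f u = 0) -> I x -> I t ->
  P_pi (tau (- t) f) x = folded f x t.
Proof.
move=> f0; rewrite /= !in_itv/= => /andP[x0 x1] /andP[t0 t1].
rewrite /P_pi /folded /tau (@fsbig_seq R 0 +%R int [:: -2; 0; 2])//.
apply/esym/fsbig_widen => //= [i|i [/= i2 iN]].
  by rewrite mksetE/= !in_cons orbF => /or3P[] /eqP ->.
(* The other even [i] satisfy [|i| >= 4]; as [x] and [t] lie in [0, 1], both arguments of [f] have
   modulus at least 2 and miss the support. *)
have /orP[i4|i4] : (i <= -4) || (4 <= i).
- move: i2 iN; rewrite /= !in_cons orbF => /dvdzP[k ->] /negP; lia.
- have : (i%:~R : R) <= (-4 : int)%:~R by rewrite ler_int.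
  by rewrite mulrNz => ?; rewrite !f0 ?addr0// ltr_normr; apply/orP; right; lra.
- have : ((4 : int)%:~R : R) <= i%:~R by rewrite ler_int.
  by move=> ?; rewrite !f0 ?addr0// ltr_normr; apply/orP; left; lra.
Qed.

Lemma normr_sum_le (r : seq int) (F : int -> R) (c : R) :
  (forall i, `|F i| <= c) -> `|\sum_(i <- r) F i| <= (size r)%:R * c.
Proof.
move=> Fc; rewrite (le_trans (ler_norm_sum _ _ _))//.
rewrite (le_trans (ler_sum _ (fun i _ => Fc i)))//.
by rewrite big_const_seq count_predT iter_addr_0 mulr_natl.
Qed.

(** Three translates with two reflected terms each give the factor 6, here and in the next two
    bounds. *)
Lemma folded_bounded f (M : R) x t : (forall u, `|f u| <= M) ->
  `|folded f x t| <= 6 * M.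
Proof.
move=> fM; rewrite (le_trans (@normr_sum_le _ _ (M + M) _))//=; last lra.
by move=> i; rewrite (le_trans (ler_normD _ _))// lerD.
Qed.

Lemma folded_lipschitz f (M : R) x t x' t' : 0 <= M ->
  (forall u v, `|f u - f v| <= M * `|u - v|) ->
  `|folded f x t - folded f x' t'| <= 6 * M * (`|x - x'| + `|t - t'|).
Proof.
move=> M0 fM; rewrite /folded -sumrB.
rewrite (le_trans (@normr_sum_le _ _ (2 * (M * (`|x - x'| + `|t - t'|))) _))//=; last lra.
move=> i; rewrite opprD addrACA mulr_natl mulr2n.
rewrite (le_trans (ler_normD _ _))// lerD//.
  rewrite (le_trans (fM _ _))// ler_wpM2l//.
  rewrite (_ : _ - _ = (x - x') - (t - t')); last by ring.
  exact: ler_normB.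
rewrite (le_trans (fM _ _))// ler_wpM2l//.
rewrite (_ : _ - _ = - ((x - x') + (t - t'))); last by ring.
by rewrite normrN ler_normD.
Qed.

Lemma folded_taylor f df (M : R) x t s : 0 <= M ->
  (forall u v, `|f u - f v - (u - v) * df v| <= M * (u - v) ^+ 2) ->
  `|folded f x t - folded f x s + (t - s) * folded df x s| <= 6 * M * (t - s) ^+ 2.
Proof.
move=> M0 fM; rewrite /folded -sumrB mulr_sumr -big_split/=.
rewrite (le_trans (@normr_sum_le _ _ (2 * (M * (t - s) ^+ 2)) _))//=; last lra.
move=> i; set a := i%:~R + x; set b := i%:~R - x.
have := fM (a - t) (a - s); have := fM (b - t) (b - s).
rewrite (_ : a - t - (a - s) = - (t - s)); last by ring.
rewrite (_ : b - t - (b - s) = - (t - s)); last by ring.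
rewrite sqrrN => h1 h2.
rewrite (_ : f (a - t) + f (b - t) - (f (a - s) + f (b - s)) +
  (t - s) * (df (a - s) + df (b - s)) = (f (a - t) - f (a - s) - - (t - s) * df (a - s)) +
  (f (b - t) - f (b - s) - - (t - s) * df (b - s))); last by ring.
by rewrite (le_trans (ler_normD _ _))// mulr_natl mulr2n lerD.
Qed.

Lemma lipschitz_bound f : lipschitz f ->
  exists2 M, 0 <= M & forall u v, `|f u - f v| <= M * `|u - v|.
Proof.
move=> /pinfty_ex_gt0[M M0 fM]; exists M; first exact: ltW.
by move=> u v; exact: (fM (u, v)).
Qed.

Lemma lipschitz_continuous f (M : R) :
  (forall u v, `|f u - f v| <= M * `|u - v|) -> continuous f.
Proof.
move=> fM x; apply/cvgrPdist_lt => e e0.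
have [M0|M0] := leP M 0.
  near=> z; rewrite (le_lt_trans (fM _ _))//.
  by rewrite (le_lt_trans _ e0)// mulr_le0_ge0.
have eM : 0 < e / M by rewrite divr_gt0.
near=> z; rewrite (le_lt_trans (fM _ _))// mulrC -ltr_pdivlMr//.
Unshelve. all: by end_near. Qed.

Lemma folded_measurable f (T : R -> R) : continuous f -> measurable_fun setT T ->
  measurable_fun setT (fun z : R * R => folded f z.1 (T z.2)).
Proof.
move=> cf mT; have mf := continuous_measurable_fun cf.
have mT2 : measurable_fun setT (fun z : R * R => T z.2) by exact: measurableT_comp.
have m1 : measurable_fun setT (fun z : R * R => z.1) by exact: measurable_fst.
apply: measurable_sum => i; apply: measurable_funD.
  apply: measurableT_comp => //; apply: measurable_funB => //.
  by apply: measurable_funD.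
apply: measurableT_comp => //; apply: measurable_funB => //.
by apply: measurable_funB.
Qed.

Lemma support_vanish rho : closure [set x | rho x != 0] `<=` `[-1, 1]%classic ->
  forall u, 1 < `|u| -> rho u = 0.
Proof.
move=> sup u u1; apply/eqP; apply: contraPT u1 => ru.
have : `[-1, 1]%classic u by apply/sup/subset_closure.
rewrite /= in_itv/= -ler_norml.
by case: ltP.
Qed.

(** The set [1 < |u|] is open, so [rho] is zero near each of its points. *)
Lemma derive1_vanish rho : (forall u, 1 < `|u| -> rho u = 0) ->
  forall u, 1 < `|u| -> derive1 rho u = 0.
Proof.
move=> r0 u u1; rewrite derive1E.
rewrite (near_eq_derive (g := cst 0)) ?derive_cst//.
have : \forall z \near u, 1 < `|z|.
  have /cvgr_gt : `|z| @[z --> u] --> `|u| by exact: cvg_norm.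
  by apply.
by apply: filterS => z /r0.
Qed.

Lemma vanish_bounded f (M : R) : 0 <= M ->
  (forall u v, `|f u - f v| <= M * `|u - v|) ->
  (forall u, 1 < `|u| -> f u = 0) -> forall u, `|f u| <= 3 * M.
Proof.
move=> M0 fM f0 u; have [u1|/f0->] := leP `|u| 1; last by rewrite normr0; lra.
(* The point 2 lies off the support and within distance 3 of every [u] with [|u| <= 1]. *)
have := fM u 2; rewrite (f0 2) ?subr0; last by rewrite ger0_norm; lra.
move=> h; apply: (le_trans h); rewrite mulrC ler_wpM2r//.
by move: u1; rewrite !ler_norml => /andP[? ?]; apply/andP; split; lra.
Qed.

(* Mean value theorem for f, Lipschitz bound for f'. *)
Lemma taylor_lipschitz f (M : R) : 0 <= M -> (forall x, derivable f x 1) ->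
  (forall u v, `|derive1 f u - derive1 f v| <= M * `|u - v|) ->
  forall u v, `|f u - f v - (u - v) * derive1 f v| <= M * (u - v) ^+ 2.
Proof.
move=> M0 df fM u v.
have der (x : R) : is_derive x (1 : R) f (derive1 f x).
  by rewrite derive1E; apply: DeriveDef.
have cf : continuous f.
  by move=> x; apply/differentiable_continuous/derivable1_diffP.
have [c cuv ->] : exists2 c, `|c - v| <= `|u - v| &
    f u - f v = derive1 f c * (u - v).
  have [uv|/ltW vu] := leP u v.
    have [c] := MVT_segment uv (fun x _ => der x) (continuous_subspaceT cf).
    rewrite in_itv/= => /andP[uc cv] e; exists c.
      by rewrite !ler0_norm ?subr_le0// lerN2 lerD2r.
    by rewrite -opprB e; ring.
  have [c] := MVT_segment vu (fun x _ => der x) (continuous_subspaceT cf).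
  rewrite in_itv/= => /andP[vc cu] e; exists c => //.
  by rewrite !ger0_norm ?subr_ge0// lerD2r.
rewrite [X in _ - X]mulrC -mulrBl normrM -real_normK ?num_real// expr2 mulrA.
by rewrite ler_wpM2r// (le_trans (fM _ _))// ler_wpM2l.
Qed.

(** A single constant, valid on the whole plane; this record and the next are all that the operator
    estimates know of the noise. *)
Record lipschitz_kernel (G : R -> R -> R) (M : R) : Prop := LipschitzKernel {
  kernel_const_ge0 : 0 <= M;
  kernel_bounded : forall x t, `|G x t| <= M;
  kernel_lipschitz : forall x t x' t',
    `|G x t - G x' t'| <= M * (`|x - x'| + `|t - t'|) }.

(* [- G1] is the derivative of [G] in its second argument. *)
Record smooth_kernel (G G1 : R -> R -> R) (M : R) : Prop := SmoothKernel {
  smooth_kernel0 : lipschitz_kernel G M;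
  smooth_kernel1 : lipschitz_kernel G1 M;
  kernel_taylor : forall x t s,
    `|G x t - G x s + (t - s) * G1 x s| <= M * (t - s) ^+ 2 }.

Lemma folded_smooth_kernel rho : lipschitz_density rho ->
  (forall x, derivable rho x 1) -> lipschitz (derive1 rho) ->
  exists M, smooth_kernel (folded rho) (folded (derive1 rho)) M.
Proof.
move=> [lip _ _ /support_vanish r0] drho lip1.
have [M0 M0ge0 M0P] := lipschitz_bound lip.
have [M1 M1ge0 M1P] := lipschitz_bound lip1.
have b0 := vanish_bounded M0ge0 M0P r0.
have b1 := vanish_bounded M1ge0 M1P (derive1_vanish r0).
have taylor := taylor_lipschitz M1ge0 drho M1P.
(* 18 is the product of the 6 terms of [folded] and the 3 of [vanish_bounded]; the Lipschitz and
   Taylor bounds need only the 6. *)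
exists (18 * (M0 + M1)); split; first split; [lra| | |split; [lra| |]|] => x t.
- by rewrite (le_trans (folded_bounded x t b0))//; lra.
- move=> x' t'; rewrite (le_trans (folded_lipschitz x t x' t' M0ge0 M0P))//.
  by rewrite ler_wpM2r ?addr_ge0//; lra.
- by rewrite (le_trans (folded_bounded x t b1))//; lra.
- move=> x' t'; rewrite (le_trans (folded_lipschitz x t x' t' M1ge0 M1P))//.
  by rewrite ler_wpM2r ?addr_ge0//; lra.
- move=> s; rewrite (le_trans (folded_taylor x t s M1ge0 taylor))//.
  by rewrite ler_wpM2r ?sqr_ge0//; lra.
Qed.

End folded_kernel.

(** * Integral operators with Lipschitz kernels *)

Section kernel_operator.
Context {R : realType}.
Local Notation m := (@lebesgue_measure R).
Local Notation I := (`[0%R, 1%R]%classic : set R).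
Implicit Types (f g h : R -> R[i]) (S T u v : R -> R) (G : R -> R -> R).

Lemma lipschitz_on_I_cmeasurable h (C : R) : 0 <= C ->
  (forall x x', I x -> I x' -> normc (h x - h x') <= C * `|x - x'|) ->
  cmeasurable h.
Proof.
(* Composition with the projection of the line onto [0, 1] extends [h] to a Lipschitz function on
   the line, which is continuous and hence measurable. *)
move=> C0 hC; pose clamp (x : R) := Num.max 0 (Num.min 1 x).
have clampI x : I (clamp x).
  by rewrite /= in_itv/= /clamp le_max lexx /= ge_max ler01 ge_min lexx.
have clampE x : I x -> clamp x = x.
  rewrite /= in_itv/= => /andP[x0 x1].
  by rewrite /clamp (min_idPr x1) (max_idPr x0).
have clampC x x' : `|clamp x - clamp x'| <= `|x - x'|.
  have := ler_norm (x - x'); have := ler_norm (x' - x); rewrite distrC.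
  rewrite /clamp ler_norml.
  case: (leP 1 x) => ?; case: (leP 1 x') => ?;
  case: (leP 0 x) => ?; case: (leP 0 x') => ?;
  case: (leP 0 (1 : R)) => ? ? ?; apply/andP; split; lra.
suff [h1 h2] : continuous (fun x => Re (h (clamp x))) /\
    continuous (fun x => Im (h (clamp x))).
  have [m1 m2] := (continuous_measurable_fun h1, continuous_measurable_fun h2).
  split.
    apply: eq_measurable_fun (measurable_funTS m1) => x /set_mem Ix.
    by rewrite clampE.
  apply: eq_measurable_fun (measurable_funTS m2) => x /set_mem Ix.
  by rewrite clampE.
have hcl x x' : normc (h (clamp x) - h (clamp x')) <= C * `|x - x'|.
  by rewrite (le_trans (hC _ _ (clampI _) (clampI _)))// ler_wpM2l.
by split; apply: (@lipschitz_continuous _ _ C) => x x'; rewrite -?Re_sub -?Im_sub;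
  rewrite (le_trans _ (hcl x x'))// ?normr_Re_le// normr_Im_le.
Qed.

Lemma integrable_bounded_I u (M : R) : measurable_fun I u ->
  (forall x, I x -> `|u x| <= M) -> m.-integrable I (EFin \o u).
Proof.
move=> mu uM; apply: le_integrable (integrable_cst_I M) => //.
  exact/measurable_EFinP.
by move=> x Ix; rewrite lee_fin (le_trans (uM x Ix))// ler_norm.
Qed.

Lemma Rintegral_le_cst_I u (c : R) : m.-integrable I (EFin \o u) ->
  (forall x, I x -> u x <= c) -> \int[m]_(x in I) u x <= c.
Proof.
move=> iu uc; apply: (@le_trans _ _ (\int[m]_(x in I) (cst c x))).
  by apply: le_Rintegral => //; exact: integrable_cst_I.
by rewrite Rintegral_cst//= lebesgue_measure_itv/= lte_fin ltr01 oppr0 adde0 mulr1.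
Qed.

Section lipschitz_operator.
Variables (G : R -> R -> R) (M : R).
Hypothesis GM : lipschitz_kernel G M.

Lemma kernel_measurable T x : measurable_fun I T ->
  measurable_fun I (fun y => G x (T y)).
Proof.
move=> mT; apply: (measurableT_comp _ mT).
apply: continuous_measurable_fun; apply: (@lipschitz_continuous _ _ M) => t t'.
by rewrite (le_trans (kernel_lipschitz GM _ _ _ _))// subrr normr0 add0r.
Qed.

Lemma kernel_cintegrable T x f : measurable_fun I T -> cintegrable f ->
  cintegrable (fun y => (G x (T y))%:C * f y).
Proof.
move=> mT; apply: (cintegrableMl (M := M)).
  by apply: cmeasurable_real; exact: kernel_measurable.
by move=> y _; rewrite normc_real (kernel_bounded GM).
Qed.

(** The variation in [x] falls on the kernel alone, so the constant sees [f] only through its L^1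
    norm and does not see [T]: this is the source of the compactness that is uniform in the
    parameter. *)
Lemma operator_lipschitz T f x x' : measurable_fun I T -> cintegrable f ->
  normc (integral_operator (fun x y => G x (T y)) f x -
         integral_operator (fun x y => G x (T y)) f x') <=
  2 * (M * \int[m]_(y in I) normc (f y)) * `|x - x'|.
Proof.
move=> mT If; rewrite /integral_operator -cintegralB; last 2 first.
- exact: kernel_cintegrable.
- exact: kernel_cintegrable.
rewrite -mulrA [X in 2 * X]mulrAC -RintegralZl//; last exact: cintegrable_normc.
apply: normc_cintegral_le.
- apply: cintegrable_measurable; apply: cintegrableB; exact: kernel_cintegrable.
- exact/integrableZl_I/cintegrable_normc.
- move=> y _; rewrite -mulrBl -rmorphB/= ComplexField.Normc.normcM normc_real.
  rewrite ler_wpM2r ?normc_ge0// (le_trans (kernel_lipschitz GM _ _ _ _))//.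
  by rewrite subrr normr0 addr0.
Qed.

Lemma operator_bounded T f x : measurable_fun I T -> cintegrable f ->
  normc (integral_operator (fun x y => G x (T y)) f x) <=
  2 * (M * \int[m]_(y in I) normc (f y)).
Proof.
move=> mT If; rewrite -RintegralZl//; last exact: cintegrable_normc.
apply: normc_cintegral_le.
- by apply: cintegrable_measurable; exact: kernel_cintegrable.
- exact/integrableZl_I/cintegrable_normc.
- move=> y _; rewrite ComplexField.Normc.normcM normc_real.
  by rewrite ler_wpM2r ?normc_ge0// (kernel_bounded GM).
Qed.

Lemma operator_cmeasurable T f : measurable_fun I T -> cintegrable f ->
  cmeasurable (integral_operator (fun x y => G x (T y)) f).
Proof.
move=> mT If.
apply: (@lipschitz_on_I_cmeasurable _ (2 * (M * \int[m]_(y in I) normc (f y)))).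
  rewrite !mulr_ge0// ?(kernel_const_ge0 GM)// Rintegral_ge0// => y _.
  exact: normc_ge0.
by move=> x x' _ _; exact: operator_lipschitz.
Qed.

Lemma operatorB T f g x : measurable_fun I T -> cintegrable f -> cintegrable g ->
  integral_operator (fun x y => G x (T y)) (fun y => f y - g y) x =
  integral_operator (fun x y => G x (T y)) f x -
  integral_operator (fun x y => G x (T y)) g x.
Proof.
move=> mT If Ig; rewrite -cintegralB; [|exact: kernel_cintegrable..].
by apply: eq_cintegral => y _; rewrite mulrBr.
Qed.

Lemma operatorZ T f (c : R[i]) x : measurable_fun I T -> cintegrable f ->
  integral_operator (fun x y => G x (T y)) (fun y => c * f y) x =
  c * integral_operator (fun x y => G x (T y)) f x.
Proof.
move=> mT If; rewrite -cintegralZl; last exact: kernel_cintegrable.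
by apply: eq_cintegral => y _; rewrite mulrCA.
Qed.

Lemma operator_conj T f x : measurable_fun I T -> cintegrable f ->
  integral_operator (fun x y => G x (T y)) (fun y => (f y)^*%C) x =
  (integral_operator (fun x y => G x (T y)) f x)^*%C.
Proof.
move=> mT If; rewrite -cintegral_conj; last exact: kernel_cintegrable.
by apply: eq_cintegral => y _; rewrite rmorphM/= oppr0.
Qed.

Lemma ae_eq_operator T f g x : measurable_fun I T ->
  cintegrable f -> cintegrable g -> ae_eq01 f g ->
  integral_operator (fun x y => G x (T y)) f x =
  integral_operator (fun x y => G x (T y)) g x.
Proof.
move=> mT If Ig fg; apply: ae_eq_cintegral.
- by apply: cintegrable_measurable; exact: kernel_cintegrable.
- by apply: cintegrable_measurable; exact: kernel_cintegrable.
- by apply: ae_eq01_mono fg => y _ ->.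
Qed.

(** The sup-norm bound on [f] makes the L^1 distance of the two maps sufficient. *)
Lemma operator_perturbation T S f x : measurable_fun I T -> measurable_fun I S ->
  m.-integrable I (EFin \o (fun y => `|T y - S y|)) ->
  cmeasurable f -> (forall y, I y -> normc (f y) <= 1) ->
  normc (integral_operator (fun x y => G x (T y)) f x -
         integral_operator (fun x y => G x (S y)) f x) <=
  2 * (M * \int[m]_(y in I) `|T y - S y|).
Proof.
move=> mT mS iTS mf f1; have If := cintegrable_bounded mf f1.
rewrite -cintegralB; [|exact: kernel_cintegrable..].
rewrite -RintegralZl//; apply: normc_cintegral_le.
- apply: cintegrable_measurable; apply: cintegrableB; exact: kernel_cintegrable.
- exact: integrableZl_I.
- move=> y Iy; rewrite -mulrBl -rmorphB/= ComplexField.Normc.normcM normc_real.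
  rewrite -[leRHS]mulr1 ler_pM ?normc_ge0 ?f1//.
  rewrite (le_trans (kernel_lipschitz GM _ _ _ _))//.
  by rewrite subrr normr0 add0r.
Qed.

End lipschitz_operator.

(** First-order expansion of the operator in the map, with [s] the parameter increment. The first
    error is the Taylor remainder of the kernel, the second comes from putting [dT] for the
    difference quotient of the maps. The sum on the left is a difference in disguise, because the
    derivative of [G] in its second argument is [- G1]. *)
Lemma operator_derivative G G1 (M : R) T S dT f (s : R) x : 0 < s ->
  smooth_kernel G G1 M -> measurable_fun I T -> measurable_fun I S ->
  m.-integrable I (EFin \o (fun y => (T y - S y) ^+ 2)) ->
  m.-integrable I (EFin \o dT) ->
  m.-integrable I (EFin \o (fun y => `|s^-1 * (T y - S y) - dT y|)) ->
  cmeasurable f -> (forall y, I y -> normc (f y) <= 1) ->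
  normc ((s^-1)%:C * (integral_operator (fun x y => G x (T y)) f x -
                      integral_operator (fun x y => G x (S y)) f x) +
         integral_operator (fun x y => G1 x (S y)) (fun y => (dT y)%:C * f y) x) <=
  2 * (M * (s^-1 * \int[m]_(y in I) (T y - S y) ^+ 2 +
            \int[m]_(y in I) `|s^-1 * (T y - S y) - dT y|)).
Proof.
move=> s0 [G0M G1M taylor] mT mS i2 idT i1 mf f1.
have If := cintegrable_bounded mf f1.
have mdT : measurable_fun I dT by move/measurable_int : idT => /measurable_EFinP.
have IdTf : cintegrable (fun y => (dT y)%:C * f y).
  under eq_fun do rewrite mulrC.
  apply: (cintegrableMl mf f1); split => //=.
  exact: (integrable_cst_I 0).
have I1 := kernel_cintegrable G0M x mT If.
have I2 := kernel_cintegrable G0M x mS If.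
have I3 := kernel_cintegrable G1M x mS IdTf.
rewrite /integral_operator -cintegralB// -cintegralZl; last exact: cintegrableB.
have I4 := cintegrableZl (s^-1)%:C (cintegrableB I1 I2).
have I5 := cintegrableZl (-1) I3.
rewrite -[X in _ + X]opprK -[X in _ - X]mulN1r -cintegralZl// -cintegralB//.
rewrite -[s^-1 * _]RintegralZl// -RintegralD//; last exact: integrableZl_I.
have I6 := integrableD_I (integrableZl_I s^-1 i2) i1.
rewrite -RintegralZl//; apply: normc_cintegral_le.
- by apply: cintegrable_measurable; exact: cintegrableB.
- exact: integrableZl_I.
move=> y Iy.
set a := T y - S y.
(* The term [G1 x (S y) * (s^-1 * a)] is added and subtracted, which separates the two errors. *)
rewrite (_ : _ - _ = (s^-1 * (G x (T y) - G x (S y) + a * G1 x (S y)) -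
    G1 x (S y) * (s^-1 * a - dT y))%:C * f y); last first.
  by rewrite !(rmorphB, rmorphD, rmorphM)/=; ring.
rewrite ComplexField.Normc.normcM normc_real -[leRHS]mulr1.
rewrite ler_pM ?normc_ge0 ?f1// (le_trans (ler_normB _ _))// [leRHS]mulrDr lerD//.
  rewrite normrM gtr0_norm ?invr_gt0// [leRHS]mulrCA ler_wpM2l ?invr_ge0 ?(ltW s0)//.
by rewrite normrM ler_wpM2r// (kernel_bounded G1M).
Qed.

End kernel_operator.

(** * Limits along ultrafilters and equi-Lipschitz families *)

Section compactness.
Context {R : realType}.
Local Notation I := (`[0%R, 1%R]%classic : set R).

(** Compactness provides a cluster point, and a cluster point of an ultrafilter is a limit: for a
    neighbourhood [A], either the preimage of [A] or that of its complement belongs to [U], and the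
    latter would be disjoint from [A]. *)
Lemma ultra_cvg_bounded {X : Type} (U : set_system X) (u : X -> R) :
  UltraFilter U -> (\forall d \near U, `|u d| <= 1) ->
  exists a : R, u @ U --> a.
Proof.
move=> UU u1; have PU : ProperFilter U by exact: ultra_proper.
have Uu : (u @ U) `[(-1 : R), 1]%classic.
  by apply: filterS u1 => d; rewrite /= in_itv/= ler_norml.
have [a [_ cla]] := @segment_compact R (-1) 1 (u @ U) _ Uu.
exists a => A nA.
have [//|UnA] := in_ultra_setVsetC (u @^-1` A) UU.
by have [z []] := cla (~` A) A UnA nA.
Qed.

(** If the preimage of a neighbourhood is not in [F], then [F] restricted to its complement is a
    proper filter, and any ultrafilter above it violates the assumption. *)
Lemma cvg_ultra {X : Type} (F : set_system X) (u : X -> R) (a : R) :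
  Filter F -> (forall U : set_system X, UltraFilter U -> F `<=` U -> u @ U --> a) ->
  u @ F --> a.
Proof.
move=> FF cvgU A nA; apply: contrapT => nFA.
pose D := ~` (u @^-1` A).
have PD : ProperFilter (within D F).
  apply: Build_ProperFilter => FD; apply: nFA.
  have : F (fun d => D d -> False) by exact: FD.
  rewrite nbhs_filterE fmapE; apply: filterS => d nD; exact: contrapT.
have [U [UU DU]] := ultraFilterLemma PD.
have FU : F `<=` U by move=> B FB; apply: DU; apply: filterS FB => d Bd _.
have UD : U D by apply: DU; apply: (@filterS _ _ FF setT) filterT => d _.
have [d [/= ]] : (D `&` (u @^-1` A)) !=set0.
  have PU : ProperFilter U by exact: ultra_proper.
  have UA : U (u @^-1` A) by exact: (cvgU U UU FU A nA).
  exact: (filter_ex (filterI UD UA)).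
by [].
Qed.

Lemma le0_small (x K : R) : 0 <= K -> (forall eta, 0 < eta -> x <= K * eta) -> x <= 0.
Proof.
move=> K0 xK; rewrite leNgt; apply/negP => x0.
have K1 : 0 < K + 1 by lra.
have := xK (x / (K + 1)) (divr_gt0 x0 K1).
rewrite mulrA ler_pdivlMr//; nra.
Qed.

(** The constant [K], independent of [eta], is absorbed once here, so that later estimates need not
    divide their tolerances in advance. *)
Lemma cvg0_small {X : Type} (F : set_system X) {FF : Filter F} (u : X -> R) (K : R) :
  0 <= K -> (forall eta, 0 < eta -> \forall d \near F, `|u d| <= K * eta) ->
  u @ F --> 0.
Proof.
move=> K0 uK; apply/cvgrPdist_le => e e0.
have K1 : 0 < K + 1 by lra.
apply: filterS (uK _ (divr_gt0 e0 K1)) => d ud.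
rewrite sub0r normrN (le_trans ud)//.
rewrite mulrA ler_pdivrMr//; nra.
Qed.

Lemma cvg0_le {X : Type} (F : set_system X) {FF : Filter F} (u : X -> R) (eta : R) :
  0 < eta -> u @ F --> 0 -> \forall d \near F, `|u d| <= eta.
Proof.
move=> eta0 /cvgrPdist_le/(_ _ eta0); apply: filterS => d.
by rewrite sub0r normrN.
Qed.

(* Arzela-Ascoli along an ultrafilter: no subsequence has to be extracted. *)
Lemma ultra_equilipschitz_cvg {X : Type} (U : set_system X) (phi : X -> R -> R[i])
    (C : R) : UltraFilter U -> 0 <= C ->
  (\forall d \near U, forall x, I x -> normc (phi d x) <= 1) ->
  (\forall d \near U, forall x x', I x -> I x' ->
     normc (phi d x - phi d x') <= C * `|x - x'|) ->
  exists2 g : R -> R[i],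
    (forall x x', I x -> I x' -> normc (g x - g x') <= C * `|x - x'|) &
    (forall eta, 0 < eta ->
       \forall d \near U, forall x, I x -> normc (phi d x - g x) <= eta).
Proof.
move=> UU C0 phi1 phiC; have PU : ProperFilter U by exact: ultra_proper.
(* Pointwise limits exist along [U] at every point of [0, 1] at once; off [0, 1] any value will
   do. *)
have /choice[g gP] : forall x, exists z, I x -> normc (phi d x - z) @[d --> U] --> 0.
  move=> x; have [Ix|nIx] := pselect (I x); last by exists 0.
  have [a aP] : exists a : R, Re (phi d x) @[d --> U] --> a.
    apply: ultra_cvg_bounded; apply: filterS phi1 => d /(_ _ Ix).
    exact/le_trans/normr_Re_le.
  have [b bP] : exists b : R, Im (phi d x) @[d --> U] --> b.
    apply: ultra_cvg_bounded; apply: filterS phi1 => d /(_ _ Ix).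
    exact/le_trans/normr_Im_le.
  exists (a +i* b) => _; apply: (@cvg0_small _ _ _ _ 2) => // eta eta0.
  have {}aP : \forall d \near U, `|a - Re (phi d x)| <= eta.
    by move/cvgrPdist_le : aP; apply.
  have {}bP : \forall d \near U, `|b - Im (phi d x)| <= eta.
    by move/cvgrPdist_le : bP; apply.
  near=> d; rewrite ger0_norm ?normc_ge0// (le_trans (normc_le_ReIm _))//.
  rewrite Re_sub Im_sub/= mulr_natl mulr2n lerD//.
    by rewrite distrC; near: d.
  by rewrite distrC; near: d.
have gC x x' : I x -> I x' -> normc (g x - g x') <= C * `|x - x'|.
  move=> Ix Ix'; rewrite -subr_le0; apply: (@le0_small _ 2) => // eta eta0.
  have h1 : \forall d \near U, `|normc (phi d x - g x)| <= eta.
    exact: cvg0_le (gP _ Ix).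
  have h2 : \forall d \near U, `|normc (phi d x' - g x')| <= eta.
    exact: cvg0_le (gP _ Ix').
  have [d [[]]] := filter_ex (filterI (filterI h1 h2) phiC).
  rewrite !(ger0_norm (normc_ge0 _)) => d1 d2 /(_ _ _ Ix Ix') d3.
  rewrite (_ : g x - g x' = - (phi d x - g x) + (phi d x - phi d x') +
    (phi d x' - g x')); last by ring.
  have := normcD (- (phi d x - g x) + (phi d x - phi d x')) (phi d x' - g x').
  have := normcD (- (phi d x - g x)) (phi d x - phi d x').
  rewrite normc_opp; lra.
exists g => // eta eta0.
(* Compactness of [0, 1], in its near-covering form, makes a local estimate uniform: [eta / 2] for
   the convergence at [x], and [eta / 4] for each of the two Lipschitz moves between [x] and [x'].
   The divisor is [C + 1] because [C] may be 0. *)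
have /compact_near_coveringP/near_covering_withinP := @segment_compact R 0 1.
apply => x Ix.
have C1 : 0 < C + 1 by lra.
have phig : \forall d \near U, normc (phi d x - g x) <= eta / 2.
  have eta2 : 0 < eta / 2 by lra.
  apply: filterS (cvg0_le eta2 (gP _ Ix)) => d.
  by rewrite ger0_norm ?normc_ge0.
have xx' : \forall x' \near x, `|x - x'| <= eta / 4 / (C + 1).
  apply: (@cvgr_dist_le _ _ _ (nbhs x) _ id x cvg_id).
  by rewrite !divr_gt0.
near=> x' d => Ix'.
rewrite (_ : phi d x' - g x' = (phi d x - g x) + (phi d x' - phi d x) +
  (g x - g x')); last by ring.
have := normcD (phi d x - g x + (phi d x' - phi d x)) (g x - g x').
have := normcD (phi d x - g x) (phi d x' - phi d x).
have := gC _ _ Ix Ix'.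
have : normc (phi d x' - phi d x) <= C * `|x - x'|.
  by rewrite distrC; apply: (near phiC).
have : normc (phi d x - g x) <= eta / 2 by near: d.
have : C * `|x - x'| <= eta / 4.
  apply: (@le_trans _ _ ((C + 1) * `|x - x'|)).
    by rewrite ler_wpM2r//; lra.
  by rewrite mulrC -ler_pdivlMr//; near: x'.
lra.
Unshelve. all: by end_near. Qed.

End compactness.

(** * Exchange of integrals on the unit square *)

Section fubini.
Context {R : realType}.
Local Notation m := (@lebesgue_measure R).
Local Notation I := (`[0%R, 1%R]%classic : set R).

(** Fubini's theorem is applied on the whole plane to functions restricted by zero; this returns the
    inner integral to [0, 1]. *)
Lemma integral_patchM (w h : R -> R) (M c : R) : measurable_fun setT w ->
  (forall y, `|w y| <= M) -> m.-integrable I (EFin \o h) ->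
  (\int[m]_y (c * (w y * (h \_ I) y))%:E = (c * \int[m]_(y in I) (w y * h y))%:E)%E.
Proof.
move=> mw wM ih.
have mh : measurable_fun I h by move/measurable_int : ih => /measurable_EFinP.
have iwh : m.-integrable I (EFin \o (fun y => w y * h y)).
  apply: le_integrable (integrableZl_I M (integrable_norm_I ih)) => //.
    by apply/measurable_EFinP; apply: measurable_funM => //; exact: measurable_funTS.
  move=> y _; rewrite lee_fin [leRHS]ger0_norm; last first.
    by rewrite mulr_ge0// (le_trans _ (wM 0)).
  by rewrite normrM ler_wpM2r.
rewrite -RintegralZl//.
have -> : (fun y => (c * (w y * (h \_ I) y))%:E) =
    (EFin \o (fun y => c * (w y * h y))) \_ I.
  apply/funext => y; rewrite /patch; case: ifPn => //= _.
  by rewrite !mulr0.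
rewrite -integral_mkcond /Rintegral fineK//; apply: integrable_fin_num => //.
exact: integrableZl_I.
Qed.

(** The integrand is dominated by [M] times the product of [|u|] and [|v|], integrable by Tonelli.
    The integrability of the outer integrand is part of the conclusion because the complex version
    must split its integrals by additivity. *)
Lemma Rintegral_exchange (k : R -> R -> R) (M : R) (u v : R -> R) :
  measurable_fun setT (fun z : R * R => k z.1 z.2) ->
  (forall x y, `|k x y| <= M) ->
  m.-integrable I (EFin \o u) -> m.-integrable I (EFin \o v) ->
  m.-integrable I (EFin \o (fun x => u x * \int[m]_(y in I) (k x y * v y))) /\
  \int[m]_(x in I) (u x * \int[m]_(y in I) (k x y * v y)) =
  \int[m]_(y in I) (v y * \int[m]_(x in I) (k x y * u x)).
Proof.
move=> mk kM iu iv.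
have iu' : m.-integrable setT (EFin \o (u \_ I)).
  by rewrite -restrict_EFin; apply/integrable_restrict => //; rewrite setTI.
have iv' : m.-integrable setT (EFin \o (v \_ I)).
  by rewrite -restrict_EFin; apply/integrable_restrict => //; rewrite setTI.
have mu' : measurable_fun setT (u \_ I) by move/measurable_int : iu' => /measurable_EFinP.
have mv' : measurable_fun setT (v \_ I) by move/measurable_int : iv' => /measurable_EFinP.
pose F (z : R * R) := ((u \_ I) z.1 * (k z.1 z.2 * (v \_ I) z.2)).
have mF : measurable_fun setT F.
  apply: measurable_funM; first exact: measurableT_comp.
  by apply: measurable_funM => //; exact: measurableT_comp.
pose N (z : R * R) := `|(u \_ I) z.1| * `|(v \_ I) z.2|.
have iN : (m \x m)%E.-integrable setT (EFin \o N).
  apply/integrable12ltyP.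
    by apply/measurable_EFinP; apply: measurable_funM;
      apply: measurableT_comp => //; exact: measurableT_comp.
  move/integrableP : iu' => [_ iu']; move/integrableP : iv' => [_ iv'].
  set c := (\int[m]_x `|(EFin \o v \_ I) x|)%E in iv'.
  have c0 : (0 <= c)%E by apply: integral_ge0.
  rewrite (_ : (fun x => _) = (fun x => `|(u \_ I) x|%:E * c)%E); last first.
    apply/funext => x; rewrite -ge0_integralZl_EFin//; last first.
      by apply/measurable_EFinP; exact: measurableT_comp.
    by apply: eq_integral => y _; rewrite /= /N normrM !normr_id EFinM.
  rewrite ge0_integralZr//; last first.
    by apply/measurable_EFinP; exact: measurableT_comp.
  by rewrite lte_mul_pinfty ?integral_ge0// ge0_fin_numE ?integral_ge0.
have iF : (m \x m)%E.-integrable setT (EFin \o F).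
  have := @integrableZl _ _ _ _ _ (@measurableT _ _) M _ iN.
  apply: le_integrable => //; first exact/measurable_EFinP.
  move=> z _; rewrite /= lee_fin [leRHS]ger0_norm; last first.
    by rewrite !mulr_ge0// (le_trans _ (kM 0 0)).
  by rewrite /F !normrM mulrCA ler_wpM2r ?mulr_ge0.
have patchM (w W : R -> R) :
    (fun x => w x * W x) \_ I = (fun x => (w \_ I) x * W x).
  by apply/funext => x; rewrite /patch; case: ifP => //; rewrite mul0r.
have FE x : (\int[m]_y (F (x, y))%:E =
    ((u \_ I) x * \int[m]_(y in I) (k x y * v y))%:E)%E.
  rewrite -(integral_patchM (M := M))//.
  exact: (measurableT_comp mk (pair1_measurable x)).
split.
  apply/(@integrable_mkcond _ _ _ m I _ measurable_I).
  rewrite restrict_EFin patchM; move: (integrable_fubini_F iF).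
  by congr (integrable _ _ _); apply/funext => x; rewrite /fubini_F FE.
have e := congr1 fine (Fubini iF).
rewrite Rintegral_mkcond [RHS]Rintegral_mkcond !patchM.
etransitivity; last (etransitivity; first exact: e).
- by congr fine; apply: eq_integral => x _; rewrite FE.
- congr fine; apply: eq_integral => y _.
  rewrite -(integral_patchM (M := M))//.
    by apply: eq_integral => x _; rewrite /F/=; congr EFin; ring.
  exact: (measurableT_comp mk (pair2_measurable y)).
Qed.

Lemma cintegral_exchange (k : R -> R -> R) (M : R) (u v : R -> R[i]) :
  measurable_fun setT (fun z : R * R => k z.1 z.2) ->
  (forall x y, `|k x y| <= M) -> cintegrable u -> cintegrable v ->
  cintegral (fun x => u x * cintegral (fun y => (k x y)%:C * v y)) =
  cintegral (fun y => v y * cintegral (fun x => (k x y)%:C * u x)).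
Proof.
move=> mk kM [u1 u2] [v1 v2].
(* The transposed kernel yields the integrability of the outer integrands on the right-hand side. *)
have mk' : measurable_fun setT (fun z : R * R => k z.2 z.1).
  have sw : measurable_fun setT (fun z : R * R => (z.2, z.1)).
    by apply: measurable_fun_pair; [exact: measurable_snd|exact: measurable_fst].
  exact: (measurableT_comp mk sw).
have kM' x y : `|k y x| <= M by [].
have exch w h iw ih := Rintegral_exchange (u := w) (v := h) mk kM iw ih.
have exch' w h iw ih := Rintegral_exchange (u := w) (v := h) mk' kM' iw ih.
have ReE w h x : Re (w * cintegral (fun y => (k x y)%:C * h y)) =
    Re w * \int[m]_(y in I) (k x y * Re (h y)) -
    Im w * \int[m]_(y in I) (k x y * Im (h y)).
  rewrite Re_mul /=; congr (_ * _ - _ * _); apply: eq_Rintegral => y _.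
    by rewrite Re_rM.
  by rewrite Im_rM.
have ReE' w h y : Re (w * cintegral (fun x => (k x y)%:C * h x)) =
    Re w * \int[m]_(x in I) (k x y * Re (h x)) -
    Im w * \int[m]_(x in I) (k x y * Im (h x)).
  rewrite Re_mul /=; congr (_ * _ - _ * _); apply: eq_Rintegral => x _.
    by rewrite Re_rM.
  by rewrite Im_rM.
have ImE w h x : Im (w * cintegral (fun y => (k x y)%:C * h y)) =
    Re w * \int[m]_(y in I) (k x y * Im (h y)) +
    Im w * \int[m]_(y in I) (k x y * Re (h y)).
  rewrite Im_mul /=; congr (_ * _ + _ * _); apply: eq_Rintegral => y _.
    by rewrite Im_rM.
  by rewrite Re_rM.
have ImE' w h y : Im (w * cintegral (fun x => (k x y)%:C * h x)) =
    Re w * \int[m]_(x in I) (k x y * Im (h x)) +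
    Im w * \int[m]_(x in I) (k x y * Re (h x)).
  rewrite Im_mul /=; congr (_ * _ + _ * _); apply: eq_Rintegral => x _.
    by rewrite Im_rM.
  by rewrite Re_rM.
apply: complex_ext => /=.
  under eq_Rintegral do rewrite ReE.
  under [RHS]eq_Rintegral do rewrite ReE'.
  rewrite RintegralB//; [|exact: (exch _ _ _ _).1..].
  rewrite RintegralB//; [|exact: (exch' _ _ _ _).1..].
  by rewrite (exch _ _ u1 v1).2 (exch _ _ u2 v2).2.
under eq_Rintegral do rewrite ImE.
under [RHS]eq_Rintegral do rewrite ImE'.
rewrite RintegralD//; [|exact: (exch _ _ _ _).1..].
rewrite RintegralD//; [|exact: (exch' _ _ _ _).1..].
by rewrite (exch _ _ u1 v2).2 (exch _ _ u2 v1).2 addrC.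
Qed.

End fubini.

(** * Eigenfunctions normalised in the supremum norm *)

Section normalized_eigenfunctions.
Context {R : realType}.
Local Notation m := (@lebesgue_measure R).
Local Notation I := (`[0%R, 1%R]%classic : set R).
Implicit Types (l : R[i]) (phi : R -> R[i]) (G : R -> R -> R).

(** The value 1 is attained at a point, and exactly, so that a uniform limit of such functions
    cannot be zero. *)
Definition normalized_eigenfunction (L : (R -> R[i]) -> R -> R[i]) l phi :=
  [/\ cmeasurable phi, (forall x, I x -> L phi x = l * phi x),
      (forall x, I x -> normc (phi x) <= 1) & exists2 x, I x & phi x = 1].

Lemma Rintegral_normc_le1 phi : cmeasurable phi ->
  (forall x, I x -> normc (phi x) <= 1) -> \int[m]_(x in I) normc (phi x) <= 1.
Proof.
move=> mphi phi1; apply: Rintegral_le_cst_I => //.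
exact/cintegrable_normc/(cintegrable_bounded mphi phi1).
Qed.

Lemma normcB_le (z w : R[i]) : `|normc z - normc w| <= normc (z - w).
Proof.
have := normcD (z - w) w; have := normcD (w - z) z.
rewrite !subrK [normc (w - z)]normcB ler_norml => ? ?; apply/andP; split; lra.
Qed.

(* [phi] is a multiple of the image of [f], so that the eigenvalue equation holds
   at every point instead of almost everywhere. *)
Lemma eigenvector_normalize G (M : R) T l f : lipschitz_kernel G M ->
  measurable_fun I T -> l != 0 ->
  is_eigenvector (integral_operator (fun x y => G x (T y))) l f ->
  exists phi,
    normalized_eigenfunction (integral_operator (fun x y => G x (T y))) l phi.
Proof.
move=> GM mT l0 [Lf fn0 Lflf]; have If := L2_cintegrable Lf.
set L := integral_operator _ in Lflf *.
pose h := L f.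
have mh : cmeasurable h := operator_cmeasurable GM mT If.
have Ih : cintegrable h.
  by apply: (cintegrable_bounded mh) => x _; exact: (operator_bounded GM).
have Lh x : L h x = l * h x.
  rewrite /h -(operatorZ GM)//; apply: (ae_eq_operator GM) => //.
  exact: cintegrableZl.
have ch : continuous (fun x => normc (h x)).
  pose C := 2 * (M * \int[m]_(y in I) normc (f y)).
  apply: (@lipschitz_continuous _ _ C) => x x'.
  by rewrite (le_trans (normcB_le _ _))//; exact: (operator_lipschitz GM).
have [c cI hc] := EVT_max ler01 (continuous_subspaceT ch).
have hc0 : h c != 0.
  apply/negP => /eqP hc0; apply: fn0; apply: ae_eq01_mono Lflf => x Ix.
  have -> : L f x = 0.
    apply/eqP; rewrite -normc_eq0 eq_le normc_ge0 andbT.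
    by have := hc x Ix; rewrite hc0 ComplexField.Normc.normc0.
  by move/esym/eqP; rewrite mulf_eq0 (negbTE l0)/= => /eqP.
exists (fun x => (h c)^-1 * h x); split.
- by apply: cmeasurableM => //; exact: cmeasurable_cst.
- by move=> x Ix; rewrite /L (operatorZ GM)// -/L Lh mulrCA.
- move=> x Ix; rewrite ComplexField.Normc.normcM ComplexField.Normc.normcV.
  rewrite mulrC ler_pdivrMr ?mul1r ?hc// lt_neqAle normc_ge0 andbT eq_sym.
  by rewrite normc_eq0.
- by exists c => //; rewrite mulVf.
Qed.

Lemma normalized_eigenfunction_conj G (M : R) T l phi : lipschitz_kernel G M ->
  measurable_fun I T ->
  normalized_eigenfunction (integral_operator (fun x y => G x (T y))) l phi ->
  normalized_eigenfunction (integral_operator (fun x y => G x (T y))) l^*%C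
    (fun x => (phi x)^*%C).
Proof.
move=> GM mT [mphi Lphi phi1 [c Ic phic]]; split.
- exact: cmeasurable_conj.
- move=> x Ix; rewrite (operator_conj GM)//; last exact: cintegrable_bounded phi1.
  by rewrite Lphi// rmorphM.
- by move=> x Ix; rewrite normc_conj phi1.
- by exists c => //; rewrite phic rmorph1.
Qed.

(** An eigenfunction is [l^-1] times its own image, so it inherits the regularity of images; the
    constant stays bounded as long as [l] stays away from 0. *)
Lemma normalized_eigenfunction_lipschitz G (M : R) T l phi :
  lipschitz_kernel G M -> measurable_fun I T -> l != 0 ->
  normalized_eigenfunction (integral_operator (fun x y => G x (T y))) l phi ->
  forall x x', I x -> I x' ->
    normc (phi x - phi x') <= 2 * M / normc l * `|x - x'|.
Proof.
move=> GM mT l0 [mphi Lphi phi1 _] x x' Ix Ix'.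
have nl0 : 0 < normc l by rewrite lt_neqAle normc_ge0 andbT eq_sym normc_eq0.
rewrite mulrAC ler_pdivlMr// mulrC -ComplexField.Normc.normcM mulrBr -!Lphi//.
have Iphi := cintegrable_bounded mphi phi1.
rewrite (le_trans (operator_lipschitz GM x x' mT Iphi))// ler_wpM2r//.
rewrite ler_wpM2l// -[leRHS]mulr1 ler_wpM2l ?(kernel_const_ge0 GM)//.
exact: Rintegral_normc_le1.
Qed.

End normalized_eigenfunctions.

(** * Derivative of an eigenvalue branch *)

Section branch_derivative.
Context {R : realType}.
Local Notation m := (@lebesgue_measure R).
Local Notation I := (`[0%R, 1%R]%classic : set R).

Lemma bounded_pairing_cintegrable (f h : R -> R[i]) (B : R) : cmeasurable f ->
  (forall x, I x -> normc (f x) <= B) -> cintegrable h ->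
  cintegrable (fun x => f x * (h x)^*%C).
Proof. by move=> mf fB Ih; exact/(cintegrableMl mf fB)/cintegrable_conj. Qed.

Lemma inner_bounded (f h : R -> R[i]) (B : R) : cmeasurable f ->
  (forall x, I x -> normc (f x) <= B) -> cintegrable h ->
  normc (inner f h) <= 2 * (B * \int[m]_(x in I) normc (h x)).
Proof.
move=> mf fB Ih; rewrite -RintegralZl//; last exact: cintegrable_normc.
apply: normc_cintegral_le.
- exact/cintegrable_measurable/(bounded_pairing_cintegrable mf fB).
- exact/integrableZl_I/cintegrable_normc.
- move=> x Ix; rewrite ComplexField.Normc.normcM normc_conj.
  by rewrite ler_wpM2r ?normc_ge0 ?fB.
Qed.

Variables (G G1 : R -> R -> R) (M : R) (T : R -> R -> R) (dT : R -> R).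
Variables (l0 : R[i]) (e ehat : R -> R[i]).
Let L d := integral_operator (fun x y => G x (T d y)).
(** [- V] is the formal derivative of [L d] at [d = 0]. *)
Let V f := integral_operator (fun x y => G1 x (T 0 y)) (fun y => (dT y)%:C * f y).

Hypothesis GM : smooth_kernel G G1 M.
Hypothesis mT0 : measurable_fun I (T 0).
Hypothesis IT0 : forall y, I y -> I (T 0 y).
Hypothesis idT : m.-integrable I (EFin \o dT).
Hypothesis l00 : l0 != 0.
Hypothesis simple : forall f, is_eigenvector (L 0) l0 f ->
  exists c : R[i], ae_eq01 f (fun x => c * e x).
Hypothesis Le : L2 e.
Hypothesis IdTe : cintegrable (fun y => (dT y)%:C * e y).
Hypothesis Iehat : cintegrable ehat.
(** The adjoint eigenvector enters only through this pairing. The factor is [l0] itself, not its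
    conjugate, which is legitimate for a real eigenvalue. *)
Hypothesis adj : forall f, L2 f -> inner (L 0 f) ehat = l0 * inner f ehat.
Hypothesis Iee : cintegrable (fun x => e x * (ehat x)^*%C).
Hypothesis eehat : inner e ehat = 1.

Let G0M : lipschitz_kernel G M := smooth_kernel0 GM.
Let G1M : lipschitz_kernel G1 M := smooth_kernel1 GM.
Let M0 : 0 <= M := kernel_const_ge0 G0M.

Lemma cintegrable_dTM f (B : R) : cmeasurable f ->
  (forall x, I x -> normc (f x) <= B) -> cintegrable (fun y => (dT y)%:C * f y).
Proof.
move=> mf fB; under eq_fun do rewrite mulrC.
by apply: (cintegrableMl mf fB); split => //=; exact: (integrable_cst_I 0).
Qed.

Section along_ultrafilter.
Variables (U : set_system R) (mu : R -> R[i]) (phi : R -> R -> R[i]).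
Hypothesis UU : UltraFilter U.
Hypothesis U0 : \forall d \near U, 0 < d.
Hypothesis mT : \forall d \near U, measurable_fun I (T d).
Hypothesis IT : \forall d \near U, forall y, I y -> I (T d y).
Hypothesis cvg1 : \int[m]_(y in I) `|T d y - T 0 y| @[d --> U] --> 0.
Hypothesis cvg2 : d^-1 * \int[m]_(y in I) (T d y - T 0 y) ^+ 2 @[d --> U] --> 0.
Hypothesis cvg3 :
  \int[m]_(y in I) `|d^-1 * (T d y - T 0 y) - dT y| @[d --> U] --> 0.
Hypothesis mul0 : normc (mu d - l0) @[d --> U] --> 0.
Hypothesis phiP : \forall d \near U, normalized_eigenfunction (L d) (mu d) (phi d).

Let PU : ProperFilter U. Proof. exact: ultra_proper. Qed.

Lemma dist_T d y : (forall y, I y -> I (T d y)) -> I y -> `|T d y - T 0 y| <= 1.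
Proof.
move=> ITd Iy; have := ITd y Iy; have := IT0 Iy.
by rewrite /= !in_itv/= ler_norml => /andP[? ?] /andP[? ?]; apply/andP; split; lra.
Qed.

Lemma integrable_dist_T d : measurable_fun I (T d) -> (forall y, I y -> I (T d y)) ->
  m.-integrable I (EFin \o (fun y => `|T d y - T 0 y|)).
Proof.
move=> mTd ITd; apply: (@integrable_bounded_I _ _ 1).
  by apply: measurableT_comp => //; exact: measurable_funB.
by move=> y Iy; rewrite normr_id dist_T.
Qed.

Lemma integrable_sqr_T d : measurable_fun I (T d) -> (forall y, I y -> I (T d y)) ->
  m.-integrable I (EFin \o (fun y => (T d y - T 0 y) ^+ 2)).
Proof.
move=> mTd ITd; apply: (@integrable_bounded_I _ _ 1).
  by apply: measurable_funX; exact: measurable_funB.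
by move=> y Iy; rewrite normrX exprn_ile1// dist_T.
Qed.

Lemma integrable_quotient_T d : measurable_fun I (T d) ->
  (forall y, I y -> I (T d y)) ->
  m.-integrable I (EFin \o (fun y => `|d^-1 * (T d y - T 0 y) - dT y|)).
Proof.
move=> mTd ITd.
have mdT : measurable_fun I dT by move/measurable_int : idT => /measurable_EFinP.
have := integrableD_I (integrableZl_I `|d^-1| (integrable_dist_T mTd ITd))
  (integrable_norm_I idT).
apply: le_integrable => //.
  apply/measurable_EFinP; apply: measurableT_comp => //.
  by apply: measurable_funB => //; apply: measurable_funM => //; exact: measurable_funB.
move=> y _; rewrite lee_fin normr_id (le_trans (ler_normB _ _))//.
by rewrite normrM ler_norm.
Qed.

(** Keeps [1 / normc (mu d)], and with it the Lipschitz constant of [phi d], bounded along [U]. *)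
Let bound_mu : \forall d \near U, normc l0 / 2 <= normc (mu d) /\ mu d != 0.
Proof.
have n0 : 0 < normc l0 / 2.
  by rewrite divr_gt0// lt_neqAle normc_ge0 andbT eq_sym normc_eq0.
apply: filterS (cvg0_le n0 mul0) => d; rewrite ger0_norm ?normc_ge0// => h.
have h2 : normc l0 / 2 <= normc (mu d).
  have := normcB_le l0 (mu d); rewrite normcB ler_norml => /andP[_]; lra.
split=> //; apply/negP => /eqP mu0; move: h2.
by rewrite mu0 ComplexField.Normc.normc0; lra.
Qed.

Lemma eigenfunction_limit : exists g, exists2 c : R[i], c != 0 &
  [/\ cmeasurable g, (forall x, I x -> normc (g x) <= 2),
    ae_eq01 g (fun x => c * e x) &
    forall eta, 0 < eta ->
      \forall d \near U, forall x, I x -> normc (phi d x - g x) <= eta].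
Proof.
have n0 : 0 < normc l0 by rewrite lt_neqAle normc_ge0 andbT eq_sym normc_eq0.
have n2 : 0 < normc l0 / 2 by rewrite divr_gt0.
have C0 : 0 <= 2 * M / (normc l0 / 2).
  by apply: divr_ge0; [exact: mulr_ge0|exact: ltW].
have phi1 : \forall d \near U, forall x, I x -> normc (phi d x) <= 1.
  by apply: filterS phiP => d [].
have phiC : \forall d \near U, forall x x', I x -> I x' ->
    normc (phi d x - phi d x') <= 2 * M / (normc l0 / 2) * `|x - x'|.
  near=> d => x x' Ix Ix'.
  have mTd : measurable_fun I (T d) by near: d.
  have phid : normalized_eigenfunction (L d) (mu d) (phi d) by near: d.
  have [mud mud0] : normc l0 / 2 <= normc (mu d) /\ mu d != 0 by near: d.
  rewrite (le_trans (normalized_eigenfunction_lipschitz G0M mTd mud0 phid Ix Ix'))//.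
  rewrite ler_wpM2r// ler_wpM2l ?mulr_ge0// lef_pV2// posrE//.
  exact: lt_le_trans mud.
have [g gC gP] := ultra_equilipschitz_cvg UU C0 phi1 phiC.
have mg := lipschitz_on_I_cmeasurable C0 gC.
have g2 x : I x -> normc (g x) <= 2.
  move=> Ix; have [d [dP1 dP2]] := filter_ex (filterI (gP 1 ltr01) phi1).
  have := dP1 x Ix; have := dP2 x Ix; have := normcB_le (g x) (phi d x).
  by rewrite normcB ler_norml => /andP[_]; lra.
have Ig := cintegrable_bounded mg g2.
have Lg x : I x -> L 0 g x = l0 * g x.
  move=> Ix; apply/eqP; rewrite -subr_eq0 -normc_eq0 eq_le normc_ge0 andbT.
  (* The constant collects the four errors of the splitting below: [2 * M] for [g] in place of
     [phi d] under [L 0], [2 * M] for [T 0] in place of [T d], 1 for the change of eigenvalue, and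
     [normc l0] for [phi d - g] outside the operator. *)
  apply: (@le0_small _ _ (4 * M + normc l0 + 1)).
    by rewrite !addr_ge0 ?mulr_ge0 ?normc_ge0.
  move=> eta eta0.
  have [d [[[[[h1 h2] h3] h4] h5] h6]] := filter_ex (filterI (filterI (filterI
    (filterI (filterI (gP eta eta0) phiP) mT) IT) (cvg0_le eta0 cvg1))
    (cvg0_le eta0 mul0)).
  have [mphi Lphi phid1 _] := h2.
  have Iphi := cintegrable_bounded mphi phid1.
  have mgphi := cmeasurableB mphi mg.
  rewrite (_ : L 0 g x - l0 * g x =
    - L 0 (fun y => phi d y - g y) x - (L d (phi d) x - L 0 (phi d) x) +
    ((mu d - l0) * phi d x + l0 * (phi d x - g x))); last first.
    by rewrite /L (operatorB G0M)// -/(L d) -/(L 0) Lphi//; ring.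
  have k1 := operator_bounded G0M x mT0 (cintegrable_bounded mgphi h1).
  have k2 := operator_perturbation G0M x h3 mT0 (integrable_dist_T h3 h4) mphi phid1.
  have k1' : \int[m]_(y in I) normc (phi d y - g y) <= eta.
    apply: Rintegral_le_cst_I => //.
    exact: (cintegrable_normc (cintegrable_bounded mgphi h1)).
  have k3 : normc ((mu d - l0) * phi d x) <= eta.
    rewrite ComplexField.Normc.normcM -[eta]mulr1 ler_pM ?normc_ge0 ?phid1//.
    by rewrite (le_trans _ h6)// ler_norm.
  have k4 : normc (l0 * (phi d x - g x)) <= normc l0 * eta.
    by rewrite ComplexField.Normc.normcM ler_wpM2l ?normc_ge0// h1.
  have k5 : M * \int[m]_(y in I) normc (phi d y - g y) <= M * eta by rewrite ler_wpM2l.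
  have k6 : M * \int[m]_(y in I) `|T d y - T 0 y| <= M * eta.
    by rewrite ler_wpM2l// (le_trans _ h5)// ler_norm.
  rewrite (le_trans (normcD _ _))//.
  have := normcD ((mu d - l0) * phi d x) (l0 * (phi d x - g x)).
  have := normcD (- L 0 (fun y => phi d y - g y) x) (- (L d (phi d) x - L 0 (phi d) x)).
  rewrite !normc_opp; rewrite -/(L 0) -/(L d) in k1 k2; lra.
have gn0 : ~ ae_eq01 g (fun=> 0).
  (* [L 0] ignores null sets while the equation [Lg] holds at every point, so vanishing almost
     everywhere becomes vanishing on all of [0, 1]. That is impossible at a point where [phi d]
     equals 1 and [g] is within 1/2 of it. *)
  move=> g0; have Lg0 x : I x -> g x = 0.
    move=> Ix; have := Lg x Ix; rewrite /L (ae_eq_operator G0M x mT0 Ig _ g0); last first.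
      by apply: (cintegrable_bounded (M := 0)) => [|? _];
        [exact: cmeasurable_cst|rewrite ComplexField.Normc.normc0].
    rewrite (_ : integral_operator _ _ _ = 0) => [/esym/eqP|].
      by rewrite mulf_eq0 (negbTE l00)/= => /eqP.
    rewrite /integral_operator (eq_cintegral (g := fun=> 0 * 0)) ?cintegralZl ?mul0r//.
      by apply: (cintegrable_bounded (M := 0)) => [|? _];
        [exact: cmeasurable_cst|rewrite ComplexField.Normc.normc0].
    by move=> y _; rewrite !mulr0.
  have h2 : (0 : R) < 2^-1 by rewrite invr_gt0.
  have [d [dP [_ _ _ [x Ix phix]]]] := filter_ex (filterI (gP _ h2) phiP).
  have := dP x Ix; rewrite phix Lg0// subr0 ComplexField.Normc.normc1; lra.
have [c gce] : exists c : R[i], ae_eq01 g (fun x => c * e x).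
  by apply: simple; split=> //; [exact: L2_bounded g2|exact: ae_eq01W].
exists g; exists c => //; apply/negP => /eqP c0; apply: gn0.
by apply: ae_eq01_mono gce => x _ ->; rewrite c0 mul0r.
Unshelve. all: by end_near. Qed.

(** With [q] the quotient of the eigenvalues, [W = <phi d, ehat>] and [z = <V e, ehat>], the proof
    rests on [(q + z) * W = <h, ehat> + z * (W - c)], where [h] tends to 0 uniformly and [W] tends
    to [c != 0]. No prior bound on [q] is required. *)
Lemma ultra_branch_derivative :
  normc ((d^-1)%:C * (mu d - l0) + inner (V e) ehat) @[d --> U] --> 0.
Proof.
have [g [c c0 [mg g2 gce gP]]] := eigenfunction_limit.
set z := inner (V e) ehat.
set E := \int[m]_(x in I) normc (ehat x).
set D := \int[m]_(x in I) `|dT x|.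
have E0 : 0 <= E by apply: Rintegral_ge0 => x _; exact: normc_ge0.
have D0 : 0 <= D by apply: Rintegral_ge0.
have nc0 : 0 < normc c by rewrite lt_neqAle normc_ge0 andbT eq_sym normc_eq0.
have Ig := cintegrable_bounded mg g2.
have IdTg := cintegrable_dTM mg g2.
have Ie := L2_cintegrable Le.
have mVe : cmeasurable (V e) := operator_cmeasurable G1M mT0 IdTe.
have Vg x : V g x = c * V e x.
  rewrite /V -(operatorZ G1M)//; apply: (ae_eq_operator G1M) => //.
    exact: cintegrableZl.
  by apply: ae_eq01_mono gce => y _ ->; rewrite mulrCA.
have Pg : inner g ehat = c.
  transitivity (inner (fun x => c * e x) ehat).
    apply: ae_eq_cintegral.
    - exact/cintegrable_measurable/(bounded_pairing_cintegrable mg g2).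
    - apply: cmeasurableM; last exact/cmeasurable_conj/cintegrable_measurable.
      exact/cintegrable_measurable/cintegrableZl.
    - by apply: ae_eq01_mono gce => x _ ->.
  transitivity (c * inner e ehat); last by rewrite eehat mulr1.
  rewrite -cintegralZl; first by apply: eq_cintegral => x _; rewrite mulrA.
  exact: Iee.
(* [K1] bounds [h / eta]: [4 * M] is the expansion error of [operator_derivative], [2 * M * D] the
   cost of [V (phi d - g)]. [K2] adds up the pairing of [h] and the term [z * (W - c)]; dividing by
   [normc W >= normc c / 2] gives the final constant. *)
pose K1 := 4 * M + 2 * M * D.
pose K2 := 2 * K1 * E + normc z * 2 * E.
apply: (@cvg0_small _ _ _ _ _ (2 * K2 / normc c)) => [|eta eta0].
  have K10 : 0 <= K1 by rewrite /K1 addr_ge0 ?mulr_ge0.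
  have K20 : 0 <= K2 by rewrite /K2 addr_ge0 ?mulr_ge0 ?normc_ge0.
  by rewrite divr_ge0 ?mulr_ge0 ?normc_ge0.
(* A second tolerance, independent of [eta], chosen so that [normc (W - c) <= normc c / 2]. *)
have eta'0 : 0 < normc c / (4 * (E + 1)) by rewrite divr_gt0// mulr_gt0//; lra.
have n1 : \forall d \near U,
    `|d^-1 * \int[m]_(y in I) (T d y - T 0 y) ^+ 2| <= eta by exact: cvg0_le.
have n2 : \forall d \near U,
    `|\int[m]_(y in I) `|d^-1 * (T d y - T 0 y) - dT y| | <= eta by exact: cvg0_le.
near=> d.
have d0 : 0 < d by near: d.
have mTd : measurable_fun I (T d) by near: d.
have ITd : forall y, I y -> I (T d y) by near: d.
have [mphi Lphi phi1 _] : normalized_eigenfunction (L d) (mu d) (phi d) by near: d.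
have h1 : forall x, I x -> normc (phi d x - g x) <= eta by near: d; exact: gP.
have h2 : forall x, I x -> normc (phi d x - g x) <= normc c / (4 * (E + 1)).
  by near: d; exact: gP.
have h3 : `|d^-1 * \int[m]_(y in I) (T d y - T 0 y) ^+ 2| <= eta by near: d.
have h4 : `|\int[m]_(y in I) `|d^-1 * (T d y - T 0 y) - dT y| | <= eta by near: d.
rewrite ger0_norm ?normc_ge0//.
set q := (d^-1)%:C * (mu d - l0).
have Iphi := cintegrable_bounded mphi phi1.
have mL0 : cmeasurable (L 0 (phi d)) := operator_cmeasurable G0M mT0 Iphi.
have mLd : cmeasurable (L d (phi d)) := operator_cmeasurable G0M mTd Iphi.
have bL0 x := operator_bounded G0M x mT0 Iphi.
have bLd x := operator_bounded G0M x mTd Iphi.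
rewrite -/(L 0) -/(L d) in bL0 bLd.
have mphig := cmeasurableB mphi mg.
set W := inner (phi d) ehat.
have WcE B : (forall x, I x -> normc (phi d x - g x) <= B) ->
    normc (W - c) <= 2 * (B * E).
  move=> hB; rewrite -Pg /W /inner -cintegralB; last 2 first.
  - exact: (bounded_pairing_cintegrable mphi phi1).
  - exact: (bounded_pairing_cintegrable mg g2).
  rewrite (eq_cintegral (g := fun x => (phi d x - g x) * (ehat x)^*%C)); last first.
    by move=> x _; rewrite mulrBl.
  exact: inner_bounded.
have Wc := WcE _ h1.
have Whalf : normc c / 2 <= normc W.
  have := normcB_le W c; rewrite ler_norml => /andP[+ _].
  have := WcE _ h2.
  have : normc c / (4 * (E + 1)) * E <= normc c / 4.
    have E1 : 0 < E + 1 by lra.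
    by rewrite invfM mulrA mulrAC ler_pdivrMr// ler_wpM2l ?divr_ge0 ?normc_ge0//; lra.
  lra.
pose h x := (d^-1)%:C * (L d (phi d) x - L 0 (phi d) x) + V g x.
have Vb := operator_bounded G1M.
have IdTphi := cintegrable_dTM mphi phi1.
have hb x : I x -> normc (h x) <= K1 * eta.
  move=> Ix.
  have k1 := operator_derivative x d0 GM mTd mT0 (integrable_sqr_T mTd ITd) idT
    (integrable_quotient_T mTd ITd) mphi phi1.
  have k2 : normc (V (fun y => phi d y - g y) x) <= 2 * (M * (eta * D)).
    rewrite /V (le_trans (Vb _ _ _ mT0 (cintegrable_dTM mphig h1)))//.
    rewrite ler_wpM2l// ler_wpM2l// /D -RintegralZl//; last exact: integrable_norm_I.
    apply: le_Rintegral => //.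
    - exact/cintegrable_normc/(cintegrable_dTM mphig h1).
    - exact/integrableZl_I/integrable_norm_I.
    - move=> y Iy; rewrite ComplexField.Normc.normcM normc_real mulrC.
      by rewrite ler_wpM2r// h1.
  have VE : V (fun y => phi d y - g y) x = V (phi d) x - V g x.
    rewrite /V -(operatorB G1M)//; apply: eq_cintegral => y _.
    by rewrite mulrBr.
  rewrite (_ : h x = ((d^-1)%:C * (L d (phi d) x - L 0 (phi d) x) + V (phi d) x) -
    V (fun y => phi d y - g y) x); last by rewrite VE /h; ring.
  rewrite (le_trans (normcD _ _))// normc_opp.
  have k3 : M * (d^-1 * \int[m]_(y in I) (T d y - T 0 y) ^+ 2 +
      \int[m]_(y in I) `|d^-1 * (T d y - T 0 y) - dT y|) <= M * (2 * eta).
    rewrite ler_wpM2l// mulr_natl mulr2n lerD//.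
      exact: le_trans (ler_norm _) h3.
    exact: le_trans (ler_norm _) h4.
  rewrite -/(V (phi d)) -/(L 0) -/(L d) in k1.
  rewrite /K1; lra.
have mVg : cmeasurable (V g) := operator_cmeasurable G1M mT0 IdTg.
have mh : cmeasurable h.
  rewrite /h; apply: cmeasurableD => //; apply: cmeasurableM.
    exact: cmeasurable_cst.
  exact: cmeasurableB.
(* The adjoint relation turns [<L 0 (phi d), ehat>] into [l0 * W], and [<L d (phi d), ehat>] is
   [mu d * W]; their difference divided by [d] is [q * W]. *)
have PhE : inner h ehat = q * W + c * z.
  have I1 := bounded_pairing_cintegrable mLd (fun x _ => bLd x) Iehat.
  have I2 := bounded_pairing_cintegrable mL0 (fun x _ => bL0 x) Iehat.
  have I3 := bounded_pairing_cintegrable mVe (fun x _ => Vb _ _ x mT0 IdTe) Iehat.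
  have I4 := cintegrableZl (d^-1)%:C (cintegrableB I1 I2).
  have I5 := cintegrableZl (- c) I3.
  have -> : q * W = (d^-1)%:C * (inner (L d (phi d)) ehat - inner (L 0 (phi d)) ehat).
    rewrite adj; last exact: L2_bounded phi1.
    have -> : inner (L d (phi d)) ehat = mu d * W.
      rewrite /W /inner -cintegralZl; last first.
        exact: (bounded_pairing_cintegrable mphi phi1).
      by apply: eq_cintegral => x Ix; rewrite Lphi// mulrA.
    by rewrite /q /W; ring.
  rewrite /z /inner -cintegralB// -cintegralZl; last exact: cintegrableB.
  rewrite -[c * _]opprK -mulNr -cintegralZl// -cintegralB//.
  by apply: eq_cintegral => x Ix; rewrite /h Vg; ring.
have PhB := inner_bounded mh hb Iehat.
have key : normc ((q + z) * W) <= K2 * eta.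
  rewrite (_ : (q + z) * W = inner h ehat + z * (W - c)); last by rewrite PhE; ring.
  rewrite (le_trans (normcD _ _))// ComplexField.Normc.normcM.
  have : normc z * normc (W - c) <= normc z * (2 * (eta * E)).
    by rewrite ler_wpM2l ?normc_ge0.
  rewrite -/E in PhB; rewrite /K2; lra.
rewrite ComplexField.Normc.normcM in key.
have := ler_wpM2l (normc_ge0 (q + z)) Whalf.
rewrite mulrAC ler_pdivlMr//; lra.
Unshelve. all: by end_near. Qed.

End along_ultrafilter.

Lemma branch_derivative (mu : R -> R[i]) (phi : R -> R -> R[i]) :
  (\forall d \near 0^'+, measurable_fun I (T d)) ->
  (\forall d \near 0^'+, forall y, I y -> I (T d y)) ->
  \int[m]_(y in I) `|T d y - T 0 y| @[d --> 0^'+] --> 0 ->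
  d^-1 * \int[m]_(y in I) (T d y - T 0 y) ^+ 2 @[d --> 0^'+] --> 0 ->
  \int[m]_(y in I) `|d^-1 * (T d y - T 0 y) - dT y| @[d --> 0^'+] --> 0 ->
  normc (mu d - l0) @[d --> 0^'+] --> 0 ->
  (\forall d \near 0^'+, normalized_eigenfunction (L d) (mu d) (phi d)) ->
  normc ((d^-1)%:C * (mu d - l0) + inner (V e) ehat) @[d --> 0^'+] --> 0.
Proof.
move=> mT IT cvg1 cvg2 cvg3 mul0 phiP; apply: cvg_ultra => U UU FU.
apply: (@ultra_branch_derivative U mu phi) => //.
- exact/FU/nbhs_right_gt.
- exact: FU.
- exact: FU.
- by move=> A nA; apply: FU; exact: cvg1.
- by move=> A nA; apply: FU; exact: cvg2.
- by move=> A nA; apply: FU; exact: cvg3.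
- by move=> A nA; apply: FU; exact: mul0.
- exact: FU.
Qed.

End branch_derivative.

(** * From L^2 differentiability of the maps to the integral estimates *)

Section differentiable_maps.
Context {R : realType}.
Local Notation m := (@lebesgue_measure R).
Local Notation I := (`[0%R, 1%R]%classic : set R).

Lemma L2_real_integrable_sqr (u : R -> R) : L2 (fun x => (u x)%:C) ->
  m.-integrable I (EFin \o (fun x => u x ^+ 2)).
Proof.
move=> /L2_integrable_sqr; congr (integrable _ _ (EFin \o _)).
by apply/funext => x; rewrite normc_real real_normK ?num_real.
Qed.

(** Cauchy-Schwarz on an interval of length 1. It is stated with a positive bound [t] in place of
    the norm, so that division by [t] is possible even if the norm is 0. *)
Lemma Rintegral_norm_le_L2norm (u : R -> R) (t : R) : L2 (fun x => (u x)%:C) ->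
  0 < t -> L2norm (fun x => (u x)%:C) <= t -> \int[m]_(x in I) `|u x| <= t.
Proof.
move=> Lu t0; have i2 := L2_real_integrable_sqr Lu.
have iu : m.-integrable I (EFin \o u) by case: (L2_cintegrable Lu).
rewrite /L2norm; under eq_Rintegral do rewrite normc_real real_normK ?num_real//.
move=> Nt; have {}Nt : \int[m]_(x in I) u x ^+ 2 <= t ^+ 2.
  rewrite -(@ler_sqrt _ _ (t ^+ 2)) ?sqr_ge0//.
  by rewrite sqrtr_sqr (le_trans Nt)// ler_norm.
(* AM-GM: [2 |u| <= t + u^2 / t] *)
have amgm : \int[m]_(x in I) `|u x| <=
    \int[m]_(x in I) ((2 * t)^-1 * u x ^+ 2 + t / 2).
  apply: le_Rintegral => //.
  - exact: integrable_norm_I.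
  - exact: integrableD_I (integrableZl_I _ i2) (integrable_cst_I _).
  - move=> x _; rewrite -[u x ^+ 2]real_normK ?num_real//.
    rewrite -subr_ge0 (_ : _ - _ = (2 * t)^-1 * (`|u x| - t) ^+ 2).
      by rewrite mulr_ge0 ?sqr_ge0// invr_ge0 mulr_ge0// ltW.
    by field; rewrite gt_eqF.
apply: (le_trans amgm); rewrite RintegralD//; last 2 first.
- exact: integrableZl_I.
- exact: integrable_cst_I.
rewrite [X in X + _]RintegralZl//.
have : \int[m]_(x in I) (t / 2) <= t / 2.
  by apply: Rintegral_le_cst_I => //; exact: integrable_cst_I.
have : (2 * t)^-1 * \int[m]_(x in I) u x ^+ 2 <= (2 * t)^-1 * t ^+ 2.
  by rewrite ler_wpM2l// invr_ge0 mulr_ge0// ltW.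
rewrite (_ : (2 * t)^-1 * t ^+ 2 = t / 2); last by field; rewrite gt_eqF.
move=> h1 h2; rewrite [leRHS]splitr; exact: lerD.
Qed.

Lemma C1_L2_right_derivative (dbar : R) (T dT : R -> R -> R) : 0 < dbar ->
  C1_L2 dbar T dT ->
  L2 (fun x => (dT 0 x)%:C) /\
  L2norm (fun x => (d^-1 * (T d x - T 0 x) - dT 0 x)%:C) @[d --> 0^'+] --> 0.
Proof.
move=> dbar0 CT; have J0 : `[0, dbar[%classic (0 : R) by rewrite /= in_itv/= lexx.
have [LdT cT _] := CT 0 J0; split=> // A nA.
have cA : \forall d \near (0 : R), d != 0 -> `[0, dbar[%classic d ->
    A (L2norm (fun x => (d^-1 * (T d x - T 0 x) - dT 0 x)%:C)).
  have : \forall d \near (0 : R), d != 0 -> `[0, dbar[%classic d ->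
    A (L2norm (fun x => ((d - 0)^-1 * (T d x - T 0 x) - dT 0 x)%:C)) := cT A nA.
  by apply: filterS => d h dn0 Jd; have := h dn0 Jd; rewrite subr0.
have lt_dbar : \forall d \near (0 : R), d < dbar.
  exact: (@cvgr_lt _ _ (nbhs (0 : R)) _ id 0 cvg_id).
apply: filterS2 cA lt_dbar => d hd dd d0; apply: hd; first by rewrite gt_eqF.
by rewrite /= in_itv/= (ltW d0).
Qed.

(** All three limits come from [T d - T 0 = d * (r d + dT 0)] with [r d] tending to 0 in L^2: the
    first integral is of order [d], the integral of the square of order [d ^+ 2]. *)
Lemma right_derivative_L1 (T dT : R -> R -> R) :
  measurable_fun I (T 0) -> (forall y, I y -> I (T 0 y)) ->
  (\forall d \near 0^'+, measurable_fun I (T d)) ->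
  (\forall d \near 0^'+, forall y, I y -> I (T d y)) ->
  L2 (fun x => (dT 0 x)%:C) ->
  L2norm (fun x => (d^-1 * (T d x - T 0 x) - dT 0 x)%:C) @[d --> 0^'+] --> 0 ->
  [/\ \int[m]_(y in I) `|T d y - T 0 y| @[d --> 0^'+] --> 0,
    d^-1 * \int[m]_(y in I) (T d y - T 0 y) ^+ 2 @[d --> 0^'+] --> 0 &
    \int[m]_(y in I) `|d^-1 * (T d y - T 0 y) - dT 0 y| @[d --> 0^'+] --> 0].
Proof.
move=> mT0 IT0 mT IT LdT cT.
pose r d y := d^-1 * (T d y - T 0 y) - dT 0 y.
have idT : m.-integrable I (EFin \o dT 0) by case: (L2_cintegrable LdT).
have mdT : measurable_fun I (dT 0) by move/measurable_int : idT => /measurable_EFinP.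
have idT2 := L2_real_integrable_sqr LdT.
have Tr d y : d != 0 -> T d y - T 0 y = d * (r d y + dT 0 y).
  by move=> d0; rewrite /r subrK mulrA divff// mul1r.
(* Membership in L^2 has to come first, since [L2norm] reads a divergent integral as 0. For fixed
   [d] the quotient of the maps is bounded by [|d^-1|], both maps taking values in [0, 1], and the
   square of a difference is at most twice the sum of the squares. *)
have Lr d : measurable_fun I (T d) -> (forall y, I y -> I (T d y)) ->
    L2 (fun y => (r d y)%:C).
  move=> mTd ITd.
  have mr : measurable_fun I (r d).
    by apply: measurable_funB => //; apply: measurable_funM => //; exact: measurable_funB.
  have [mr1 mr2] := cmeasurable_real mr; split => //.
  have ib : m.-integrable I (EFin \o (fun y => 2 * `|d^-1| ^+ 2 + 2 * dT 0 y ^+ 2)).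
    exact: integrableD_I (integrable_cst_I _) (integrableZl_I 2 idT2).
  suff /integrableP[_] : m.-integrable I (EFin \o (fun y => normc (r d y)%:C ^+ 2)).
    congr (_ < +oo)%E; apply: eq_integral => y _.
    by rewrite gee0_abs// lee_fin sqr_ge0.
  apply: le_integrable ib => //.
    apply/measurable_EFinP; apply: measurable_funX.
    exact: (cmeasurable_normc (cmeasurable_real mr)).
  move=> y Iy; rewrite lee_fin [leLHS]ger0_norm ?sqr_ge0//.
  rewrite [leRHS]ger0_norm; last by rewrite addr_ge0// mulr_ge0// sqr_ge0.
  have Td := dist_T IT0 ITd Iy.
  have : `|d^-1 * (T d y - T 0 y)| <= `|d^-1|.
    by rewrite normrM -[leRHS]mulr1 ler_wpM2l.
  rewrite normc_real real_normK ?num_real// /r.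
  set a := d^-1 * _ => ha.
  have : a ^+ 2 <= `|d^-1| ^+ 2 by rewrite -[a ^+ 2]real_normK ?num_real// lerXn2r ?nnegrE.
  have := sqr_ge0 (a + dT 0 y); rewrite sqrrD sqrrB; lra.
have cvg3 : \int[m]_(y in I) `|r d y| @[d --> 0^'+] --> 0.
  apply: (@cvg0_small _ _ _ _ _ 1) => // eta eta0; have n1 := cvg0_le eta0 cT.
  near=> d; rewrite mul1r ger0_norm ?Rintegral_ge0//.
  apply: Rintegral_norm_le_L2norm => //.
    by apply: Lr; near: d.
  by rewrite (le_trans (ler_norm _))//; near: d; exact: n1.
have n1 := cvg0_le ltr01 cT.
split => //.
- pose D := \int[m]_(y in I) `|dT 0 y|.
  have D0 : 0 <= D by exact: Rintegral_ge0.
  apply: (@cvg0_small _ _ _ _ _ (1 + D)) => [|eta eta0]; first by lra.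
  near=> d; have d0 : 0 < d by near: d; exact: nbhs_right_gt.
  have dn0 : d != 0 by rewrite gt_eqF.
  have mTd : measurable_fun I (T d) by near: d.
  have ITd : forall y, I y -> I (T d y) by near: d.
  have ir : m.-integrable I (EFin \o r d) by case: (L2_cintegrable (Lr _ mTd ITd)).
  rewrite ger0_norm ?Rintegral_ge0//.
  apply: (@le_trans _ _ (d * (1 + D))); last first.
    rewrite mulrC ler_wpM2l//; first lra.
    by near: d; exact: nbhs_right_le.
  have r1 : \int[m]_(y in I) `|r d y| <= 1.
    apply: Rintegral_norm_le_L2norm => //; first exact: Lr.
    by rewrite (le_trans (ler_norm _))//; near: d; exact: n1.
  have := lerD r1 (lexx D).
  rewrite -RintegralD//; [|exact: integrable_norm_I..].
  move=> /(ler_wpM2l (ltW d0)); apply: le_trans.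
  rewrite -RintegralZl//; last first.
    exact: integrableD_I (integrable_norm_I ir) (integrable_norm_I idT).
  apply: le_Rintegral => //.
  + exact: integrable_dist_T.
  + exact/integrableZl_I/(integrableD_I (integrable_norm_I ir) (integrable_norm_I idT)).
  + by move=> y _; rewrite Tr// normrM gtr0_norm// ler_wpM2l ?(ltW d0)// ler_normD.
- pose D := \int[m]_(y in I) dT 0 y ^+ 2.
  have D0 : 0 <= D by apply: Rintegral_ge0 => y _; exact: sqr_ge0.
  (* The 2 comes from [(r + dT) ^+ 2 <= 2 * (r ^+ 2 + dT ^+ 2)], and [1 + D] bounds the integral of
     the bracket once the norm of [r d] is at most 1; the remaining factor [d] is eventually below
     [eta]. *)
  apply: (@cvg0_small _ _ _ _ _ (2 * (1 + D))) => [|eta eta0]; first by lra.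
  near=> d; have d0 : 0 < d by near: d; exact: nbhs_right_gt.
  have dn0 : d != 0 by rewrite gt_eqF.
  have mTd : measurable_fun I (T d) by near: d.
  have ITd : forall y, I y -> I (T d y) by near: d.
  have ir2 := L2_real_integrable_sqr (Lr _ mTd ITd).
  rewrite ger0_norm; last first.
    by rewrite mulr_ge0 ?invr_ge0 ?(ltW d0)// Rintegral_ge0// => y _; exact: sqr_ge0.
  apply: (@le_trans _ _ (2 * (1 + D) * d)); last first.
    rewrite ler_wpM2l//; first lra.
    by near: d; exact: nbhs_right_le.
  have r1 : \int[m]_(y in I) r d y ^+ 2 <= 1.
    have : L2norm (fun y => (r d y)%:C) <= 1.
      by rewrite (le_trans (ler_norm _))//; near: d; exact: n1.
    rewrite /L2norm; under eq_Rintegral do rewrite normc_real real_normK ?num_real//.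
    by rewrite -[leRHS]sqrtr1 ler_sqrt.
  rewrite mulrC ler_pdivrMr//.
  have := lerD r1 (lexx D); rewrite -RintegralD//.
  have d2 : 0 <= 2 * d ^+ 2 by rewrite mulr_ge0 ?sqr_ge0.
  move=> /(ler_wpM2l d2).
  rewrite -RintegralZl//; last exact: integrableD_I.
  rewrite (_ : 2 * (1 + D) * d * d = 2 * d ^+ 2 * (1 + D)); last by ring.
  apply: le_trans; apply: le_Rintegral => //.
  + exact: integrable_sqr_T.
  + exact/integrableZl_I/integrableD_I.
  + move=> y _; rewrite Tr// exprMn -[leRHS]mulrA [leRHS]mulrCA ler_wpM2l ?sqr_ge0//.
    have := sqr_ge0 (r d y - dT 0 y); nra.
Unshelve. all: by end_near. Qed.

End differentiable_maps.

(** * The L^2 pairing and the adjoint eigenvalue *)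

Section adjoint_pairing.
Context {R : realType}.
Local Notation m := (@lebesgue_measure R).
Local Notation I := (`[0%R, 1%R]%classic : set R).

Lemma L2_conj (f : R -> R[i]) : L2 f -> L2 (fun x => (f x)^*%C).
Proof.
move=> Lf; have [m1 m2] := cmeasurable_conj (L2_cmeasurable Lf).
split=> //; have [_ _] := Lf; congr (_ < +oo)%E; apply: eq_integral => x _.
by rewrite normc_conj.
Qed.

Lemma L2_pairing_cintegrable (f g : R -> R[i]) : L2 f -> L2 g ->
  cintegrable (fun x => f x * (g x)^*%C).
Proof. by move=> Lf Lg; apply: L2_cintegrableM => //; exact: L2_conj. Qed.

Lemma ae_eq_innerr (f g h : R -> R[i]) : L2 f -> L2 g -> L2 h -> ae_eq01 g h ->
  inner f g = inner f h.
Proof.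
move=> Lf Lg Lh gh; apply: ae_eq_cintegral.
- exact/cintegrable_measurable/L2_pairing_cintegrable.
- exact/cintegrable_measurable/L2_pairing_cintegrable.
- by apply: ae_eq01_mono gh => x _ ->.
Qed.

Lemma ae_eq_innerl (f g h : R -> R[i]) : L2 f -> L2 g -> L2 h -> ae_eq01 g h ->
  inner g f = inner h f.
Proof.
move=> Lf Lg Lh gh; apply: ae_eq_cintegral.
- exact/cintegrable_measurable/L2_pairing_cintegrable.
- exact/cintegrable_measurable/L2_pairing_cintegrable.
- by apply: ae_eq01_mono gh => x _ ->.
Qed.

Lemma L2Z (c : R[i]) (f : R -> R[i]) : L2 f -> L2 (fun x => c * f x).
Proof.
move=> Lf; have [m1 m2] := cmeasurableM (cmeasurable_cst c) (L2_cmeasurable Lf).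
split=> //; have i2 := integrableZl_I (normc c ^+ 2) (L2_integrable_sqr Lf).
have /integrableP[_] := i2; congr (_ < +oo)%E; apply: eq_integral => x _.
rewrite gee0_abs/=; first by rewrite ComplexField.Normc.normcM exprMn.
by rewrite lee_fin mulr_ge0 ?sqr_ge0.
Qed.

Lemma eq_L2 (f g : R -> R[i]) : (forall x, I x -> f x = g x) -> L2 f -> L2 g.
Proof.
move=> fg [f1 f2 foo]; split.
- by apply: eq_measurable_fun f1 => x /set_mem Ix; rewrite fg.
- by apply: eq_measurable_fun f2 => x /set_mem Ix; rewrite fg.
- by move: foo; congr (_ < +oo)%E; apply: eq_integral => x /set_mem Ix; rewrite fg.
Qed.

Lemma innerZl (c : R[i]) (f g : R -> R[i]) : L2 f -> L2 g ->
  inner (fun x => c * f x) g = c * inner f g.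
Proof.
move=> Lf Lg; rewrite /inner -cintegralZl; last exact: L2_pairing_cintegrable.
by apply: eq_cintegral => x _; rewrite mulrA.
Qed.

Lemma innerZr (c : R[i]) (f g : R -> R[i]) : L2 f -> L2 g ->
  inner f (fun x => c * g x) = c^*%C * inner f g.
Proof.
move=> Lf Lg; rewrite /inner -cintegralZl; last exact: L2_pairing_cintegrable.
by apply: eq_cintegral => x _; rewrite rmorphM mulrCA.
Qed.

(** [<L e, ehat>] is evaluated on both sides of the adjoint relation: the first slot of the pairing
    releases [l], the second, being conjugate-linear, releases its conjugate. *)
Lemma adjoint_eigenvalue_conj (L Ls : (R -> R[i]) -> R -> R[i]) (l : R[i])
    (e ehat : R -> R[i]) : is_adjoint L Ls -> L2 (L e) -> is_eigenvector L l e ->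
  is_eigenvector Ls l ehat -> inner e ehat = 1 -> l^*%C = l.
Proof.
move=> [LsL2 adj] LLe [Le _ Lel] [Lehat _ Lsehat] eehat.
have := adj _ _ Le Lehat.
rewrite (ae_eq_innerl Lehat LLe (L2Z l Le) Lel) innerZl// eehat mulr1.
by rewrite (ae_eq_innerr Le (LsL2 _ Lehat) (L2Z l Lehat) Lsehat) innerZr// eehat mulr1.
Qed.

Lemma measurable_restrict_I (T : R -> R) :
  measurable_fun I T -> measurable_fun setT (T \_ I).
Proof. exact: (measurable_restrictT T (measurable_itv _)).1. Qed.

End adjoint_pairing.

(** * The derivative formula for the noise kernels *)

Theorem proposition6p6 (R : realType) (dbar : R) (T dT : R -> R -> R)
  (rho : R -> R) (lambda : R -> R[i])
  (L0s : (R -> R[i]) -> (R -> R[i])) (e ehat : R -> R[i]) :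
  let I := `[0, 1]%classic : set R in
  let J := `[0, dbar[%classic : set R in
  let L d := integral_operator (noise_kernel rho (T d)) in
  let H (y : R) : R[i] := - ((e y)^*)%C *
    cintegral (fun x => (P_pi (tau (- T 0 y) (derive1 rho)) x)%:C * ehat x) in
  0 < dbar ->
  (forall d, J d -> measurable_fun I (T d)) ->
  (forall d x, J d -> I x -> I (T d x)) ->
  lipschitz_density rho ->
  (forall x, derivable rho x 1) ->
  lipschitz (derive1 rho) ->
  C1_L2 dbar T dT ->
  (forall d, J d -> second_largest_eigenvalue (L d) (lambda d)) ->
  (forall d, J d -> `|lambda d| < 1) ->
  (lambda d : R[i]^o) @[d --> 0^'+] --> (lambda 0 : R[i]^o) ->
  lambda 0 != 0 ->
  A1 (L 0) ->
  geometrically_simple (L 0) (lambda 0) ->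
  is_adjoint (L 0) L0s ->
  is_eigenvector (L 0) (lambda 0) e ->
  is_eigenvector L0s (lambda 0) ehat ->
  cintegral (fun x => e x * ((ehat x)^*)%C) = 1 ->
  ((d^-1)%:C * (lambda d - lambda 0) : R[i]^o) @[d --> 0^'+]
    --> (inner H (fun y => (dT 0 y)%:C) : R[i]^o).
Proof.
move=> I J L H dbar0 mT IT rhoP drho lipdrho CT eigL _ cvgl l00 _ [e' e'P simple].
move=> adj eP ehatP eehat.
have J0 : J 0 by rewrite /J /= in_itv/= lexx.
have [M GM] := folded_smooth_kernel rhoP drho lipdrho.
have rho0 : forall u, 1 < `|u| -> rho u = 0.
  by case: rhoP => _ _ _; exact: support_vanish.
have drho0 := derive1_vanish rho0.
have G0M := smooth_kernel0 GM.
have G1M := smooth_kernel1 GM.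
pose G := folded rho.
pose G1 := folded (derive1 rho).
pose op d := integral_operator (fun x y => G x (T d y)).
(* The two kernels agree only for [x] and [T d y] in [0, 1], so the operators agree on [0, 1] alone;
   almost-everywhere notions such as [is_eigenvector] cannot tell them apart. *)
have LE d f x : J d -> I x -> L d f x = op d f x.
  move=> Jd Ix; apply: eq_cintegral => y Iy; congr (_%:C * _).
  by apply: P_pi_folded => //; exact: IT.
have eigE d l f : J d -> is_eigenvector (L d) l f <-> is_eigenvector (op d) l f.
  move=> Jd; split=> -[Lf fn0 fl].
    by split; [exact: Lf|exact: fn0|]; apply: ae_eq01_mono fl => x Ix; rewrite LE.
  by split; [exact: Lf|exact: fn0|]; apply: ae_eq01_mono fl => x Ix; rewrite -LE.
have [LdT cT] := C1_L2_right_derivative dbar0 CT.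
have nearJ : \forall d \near 0^'+, J d.
  near=> d; rewrite /J /= in_itv/=; apply/andP; split.
    by apply/ltW; near: d; exact: nbhs_right_gt.
  by near: d; exact: nbhs_right_lt.
have mT0 := mT 0 J0.
have IT0 y : I y -> I (T 0 y) by exact: IT.
have nmT : \forall d \near 0^'+, measurable_fun I (T d).
  by apply: filterS nearJ => d /mT.
have nIT : \forall d \near 0^'+, forall y, I y -> I (T d y).
  by apply: filterS nearJ => d Jd y; exact: IT.
have [c1 c2 c3] := right_derivative_L1 mT0 IT0 nmT nIT LdT cT.
have idT : (@lebesgue_measure R).-integrable I (EFin \o dT 0) by case: (L2_cintegrable LdT).
have [Le en0 Lel] := eP.
have [Lehat _ _] := ehatP.
have Ie := L2_cintegrable Le.
have Iehat := L2_cintegrable Lehat.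
have opL2 f : L2 f -> L2 (op 0 f).
  move=> /L2_cintegrable If; apply: L2_bounded.
    exact: operator_cmeasurable G0M _ _ mT0 If.
  by move=> x _; exact: (operator_bounded G0M x mT0 If).
have LL2 f : L2 f -> L2 (L 0 f).
  by move/opL2; apply: eq_L2 => x Ix; rewrite LE.
have l0J : (lambda 0)^*%C = lambda 0.
  exact: adjoint_eigenvalue_conj adj (LL2 _ Le) eP ehatP eehat.
have adj0 f : L2 f -> inner (op 0 f) ehat = lambda 0 * inner f ehat.
  move=> Lf; have [LsL2 adjE] := adj; have [_ _ Lsehat] := ehatP.
  transitivity (inner (L 0 f) ehat).
    by apply: eq_cintegral => x Ix; rewrite LE.
  rewrite adjE// (ae_eq_innerr Lf (LsL2 _ Lehat) (L2Z (lambda 0) Lehat) Lsehat).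
  by rewrite innerZr// l0J.
(* Simplicity is witnessed by some [e']; since [e] is a nonzero multiple of [e'], it can serve as
   the generator instead. *)
have simple0 f : is_eigenvector (op 0) (lambda 0) f ->
    exists c : R[i], ae_eq01 f (fun x => c * e x).
  move=> fP; have [c fc] := simple f ((eigE _ _ _ J0).2 fP).
  have [c' ec'] := simple e eP.
  have c'0 : c' != 0.
    apply/negP => /eqP c'0; apply: en0.
    by apply: ae_eq01_mono ec' => x _ ->; rewrite c'0 mul0r.
  exists (c / c'); apply: ae_eq01_mono2 fc ec' => x _ -> ->.
  by rewrite mulrA divfK.
have IdTe : cintegrable (fun y => (dT 0 y)%:C * e y) := L2_cintegrableM LdT Le.
(* An eigenfunction is picked for each parameter, normalised, and conjugated; the kernel being real,
   this gives the conjugate eigenvalue. The value 0 is a placeholder where [d] is outside [J] or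
   [lambda d] is zero. *)
have /choice[phi phiP] : forall d, exists phi, J d -> lambda d != 0 ->
    normalized_eigenfunction (op d) (lambda d)^*%C phi.
  move=> d; have [[Jd ld0]|nJd] := pselect (J d /\ lambda d != 0); last first.
    by exists (fun=> 0) => Jd ld0; case: nJd.
  have [[f fP] _] := eigL d Jd.
  have [phi phiP] := eigenvector_normalize G0M (mT d Jd) ld0 ((eigE _ _ _ Jd).1 fP).
  exists (fun x => (phi x)^*%C) => _ _.
  exact: normalized_eigenfunction_conj G0M (mT d Jd) phiP.
have cl : normc ((lambda d)^*%C - lambda 0) @[d --> 0^'+] --> 0.
  rewrite (_ : (fun d => normc _) = (fun d => normc (lambda d - lambda 0))).
    exact/cvgc_normcP.
  by apply/funext => d; rewrite -[in LHS]l0J -rmorphB normc_conj.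
have nphi : \forall d \near 0^'+,
    normalized_eigenfunction (op d) (lambda d)^*%C (phi d).
  have n0 : 0 < normc (lambda 0) by rewrite lt_neqAle normc_ge0 andbT eq_sym normc_eq0.
  have /cvgrPdist_lt/(_ _ n0) cl' := cl.
  (* Within distance [normc (lambda 0)] of [lambda 0] an eigenvalue cannot be 0. *)
  apply: filterS2 nearJ cl' => d Jd; rewrite sub0r normrN ger0_norm ?normc_ge0// => ld.
  apply: phiP => //; apply/negP => /eqP ld0; move: ld.
  by rewrite ld0 rmorph0 sub0r normc_opp ltxx.
have key := branch_derivative GM mT0 IT0 idT l00 simple0 Le IdTe Iehat adj0
  (L2_pairing_cintegrable Le Lehat) eehat nmT nIT c1 c2 c3 cl nphi.
set Ve := integral_operator _ _ in key.
(* [H] is conjugate-linear in [e] and linear in [ehat], the opposite of [<Ve, ehat>]: hence the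
   conjugate. The sign is the one carried by [H]. *)
have HE : inner H (fun y => (dT 0 y)%:C) = - (inner Ve ehat)^*%C.
  (* [T 0] is measurable on [0, 1] only; extending it by 0 makes the kernel measurable on the plane,
     as the exchange of integrals requires. *)
  pose k (x y : R) := G1 x ((T 0 \_ I) y).
  have kE x y : I y -> k x y = G1 x (T 0 y).
    by move=> Iy; rewrite /k patchE mem_set.
  have mk : measurable_fun setT (fun z : R * R => k z.1 z.2).
    apply: folded_measurable; last exact: measurable_restrict_I.
    by have [K _ KP] := lipschitz_bound lipdrho; exact: lipschitz_continuous KP.
  have IVe : cintegrable (fun x => Ve x * (ehat x)^*%C).
    apply: (bounded_pairing_cintegrable (operator_cmeasurable G1M mT0 IdTe) _ Iehat).
    by move=> x _; exact: (operator_bounded G1M x mT0 IdTe).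
  have IdTeJ : cintegrable (fun y => (dT 0 y)%:C * (e y)^*%C).
    exact: L2_pairing_cintegrable.
  transitivity (cintegral (fun y => -1 * ((dT 0 y)%:C * (e y)^*%C) *
      cintegral (fun x => (k x y)%:C * ehat x))).
    apply: eq_cintegral => y Iy; rewrite conjc_real /H.
    rewrite (@eq_cintegral _ _ (fun x => (k x y)%:C * ehat x)); last first.
      move=> x Ix; rewrite kE//; congr (_%:C * _); apply: P_pi_folded => //.
      exact: IT0.
    by ring.
  rewrite -(cintegral_exchange mk (fun x y => kernel_bounded G1M _ _) Iehat
    (cintegrableZl (-1) IdTeJ)).
  rewrite -[RHS]mulN1r /inner -(cintegral_conj IVe) -[RHS]cintegralZl; last first.
    exact: cintegrable_conj.
  apply: eq_cintegral => x Ix.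
  have -> : (Ve x * (ehat x)^*%C)^*%C = (Ve x)^*%C * ehat x.
    by rewrite rmorphM /= conjcK.
  rewrite mulrA [RHS]mulrC.
  congr (_ * _).
  rewrite -[(Ve x)^*%C](operator_conj G1M x mT0 IdTe).
  rewrite -(operatorZ G1M _ x mT0 (cintegrable_conj IdTe)).
  apply: eq_cintegral => y Iy; rewrite kE//.
  have -> // : ((dT 0 y)%:C * e y)^*%C = (dT 0 y)%:C * (e y)^*%C.
  by rewrite rmorphM; congr (_ * _); exact: conjc_real.
(* Conjugation preserves the modulus, so the limit for the conjugate branch is the claimed one. *)
apply/cvgc_normcP; rewrite (_ : (fun d => normc _) =
  (fun d => normc ((d^-1)%:C * ((lambda d)^*%C - lambda 0) + inner Ve ehat))) //.
apply/funext => d; rewrite HE opprK -[RHS]normc_conj; congr normc.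
rewrite rmorphD rmorphM rmorphB; congr (_ * (_ - _) + _); last exact: esym l0J.
  exact/esym/conjc_real.
exact/esym/conjcK.
Unshelve. all: by end_near. Qed.
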